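(* Let $S\subset\mathbb{R}^2$ be an indecomposable saturated set. Then there exists an open set $\mathbb{S}\subset\mathbb{R}^2$ such that $\|\chi_{S}-\chi_{\mathbb{S}}\|_{BV(\mathbb{R}^2)}=0$.
   Context: $\chi_A$ denotes the characteristic function of $A$ and $|A|$ Lebesgue measure. The norm is $\|u\|_{BV(\mathbb{R}^2)}=\|u\|_{L^1(\mathbb{R}^2)}+|Du|(\mathbb{R}^2)$. A measurable set $E\subset\mathbb{R}^2$ is of finite perimeter if $\mathrm{Per}(E):=\sup\{\int_E \mathrm{div}\,\phi : \phi\in [C^1_c(\mathbb{R}^2)]^2,\ \|\phi\|_\infty\le 1\}<\infty$. A set $E$ of finite perimeter is indecomposable if whenever $E=A\cup B$ with $A,B$ disjoint and $\mathrm{Per}(E)=\mathrm{Per}(A)+\mathrm{Per}(B)$, then $|A|=0$ or $|B|=0$. The indecomposable components of a set $E$ of finite perimeter are the members of the (unique up to null sets) at most countable family of pairwise disjoint indecomposable sets $E_i$ with $|E_i|>0$, $|E\,\triangle\,\bigcup_i E_i|=0$, $\mathrm{Per}(E)=\sum_i \mathrm{Per}(E_i)$, and such that every indecomposable subset of $E$ is contained, up to a null set, in some $E_i$. A hole of a set $S$ of finite perimeter is an indecomposable component of $S^c$ with finite measure; $S$ is saturated if it is (up to a null set) the union of itself and all its holes. *)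

(* Defs.v *)
From HB Require Import structures.
From mathcomp Require Import all_boot all_order all_algebra.
From mathcomp Require Import all_classical all_reals all_analysis.

Set Implicit Arguments.
Unset Strict Implicit.
Unset Printing Implicit Defensive.

Import Order.TTheory GRing.Theory Num.Theory.
Import numFieldNormedType.Exports.

Local Open Scope classical_set_scope.
Local Open Scope ring_scope.

(* The completion of the product of two one-dimensional Lebesgue measures: its
   measurable sets are all the Lebesgue measurable subsets of the plane, and not
   only the Borel ones. *)
Definition lebesgue2 (R : realType) :=
  @completed_measure_extension _ _ R
    (@lebesgue_measure R \x @lebesgue_measure R)%E.

HB.instance Definition _ (R : realType) := Measure.on (@lebesgue2 R).

Definition lebesgue2_measurable (R : realType) : set (set (R * R)) :=
  ((@lebesgue_measure R \x @lebesgue_measure R)%E^*)%mu.-cara.-measurable.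

Definition div2 (R : realType) (phi : R * R -> R * R) (x : R * R) : R :=
  ('D_(1, 0) phi x).1 + ('D_(0, 1) phi x).2.

Definition continuously_differentiable (R : realType)
    (phi : R * R -> R * R) : Prop :=
  (forall x, differentiable phi x) /\
  (forall v, continuous (fun x => 'D_v phi x)).

(* The sup norm is taken with respect to the Euclidean norm of the plane; the
   library norm `|phi x| on a product is the max norm, which would give the
   anisotropic perimeter. *)
Definition test_field (R : realType) (phi : R * R -> R * R) : Prop :=
  [/\ continuously_differentiable phi,
      compact (closure [set x | phi x != 0]) &
      forall x, Num.sqrt ((phi x).1 ^+ 2 + (phi x).2 ^+ 2) <= 1].

Local Open Scope ereal_scope.

Definition perimeter (R : realType) (E : set (R * R)) : \bar R :=
  ereal_sup [set \int[@lebesgue2 R]_(x in E) (div2 phi x)%:E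
            | phi in @test_field R].

Definition finite_perimeter (R : realType) (E : set (R * R)) : Prop :=
  lebesgue2_measurable E /\ perimeter E < +oo.

Definition indecomposable (R : realType) (E : set (R * R)) : Prop :=
  finite_perimeter E /\
  forall A B : set (R * R),
    lebesgue2_measurable A -> lebesgue2_measurable B ->
    E = A `|` B -> A `&` B = set0 ->
    perimeter E = perimeter A + perimeter B ->
    lebesgue2 A = 0 \/ lebesgue2 B = 0.

(* "C is the family of indecomposable components of E".  The maximality clause
   ranges over non-null sets: null sets are indecomposable, so without this
   restriction a null E, whose family of components is empty, would have no such
   family at all; when C is nonempty the restriction is immaterial. *)
Definition indecomposable_components (R : realType)
    (E : set (R * R)) (C : set (set (R * R))) : Prop :=
  [/\ finite_perimeter E, countable C & trivIset C id] /\
  [/\ forall A, C A -> indecomposable A /\ 0 < lebesgue2 A,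
      lebesgue2 (E `+` \bigcup_(A in C) A) = 0,
      perimeter E = \esum_(A in C) perimeter A &
      forall F, indecomposable F -> F `<=` E -> 0 < lebesgue2 F ->
        exists2 A, C A & lebesgue2 (F `\` A) = 0].

(* The holes of S, given the family C of indecomposable components of ~` S;
   components, hence holes, are determined up to null sets only. *)
Definition holes (R : realType) (C : set (set (R * R))) : set (set (R * R)) :=
  [set H | C H /\ lebesgue2 H < +oo].

Definition saturated (R : realType) (S : set (R * R)) : Prop :=
  finite_perimeter S /\
  exists2 C, indecomposable_components (~` S) C &
    lebesgue2 (S `+` (S `|` \bigcup_(H in holes C) H)) = 0.

(* |Du|(R^2), which is +oo when the distributional gradient of u is not a finite
   measure. *)
Definition total_variation2 (R : realType) (u : R * R -> R) : \bar R :=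
  ereal_sup [set \int[@lebesgue2 R]_x (u x * div2 phi x)%:E
            | phi in @test_field R].

Definition BVnorm (R : realType) (u : R * R -> R) : \bar R :=
  'N[@lebesgue2 R]_1[EFin \o u] + total_variation2 u.

(* Main.v *)
Require Import Defs.
From mathcomp Require Import all_boot all_order all_algebra.
From mathcomp Require Import all_classical all_reals all_analysis.
From mathcomp Require Import measurable_realfun ring lra.
From mathcomp Require finmap.
Import Order.TTheory GRing.Theory Num.Theory.
Import numFieldNormedType.Exports.

(* Every component of ~S has infinite measure, for otherwise it would be a hole of
   the saturated set S.  If ~S has zero trace on the boundary of a rectangle Q,
   gluing test fields across that boundary gives Per A = Per (A /\ Q) + Per (A \ Q)
   for every component A of ~S; as A \ Q is not null, A /\ Q is null by
   indecomposability, and so Q \ S is null.  The open set is the union of the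
   rational boxes V with V \ S null, which contains all these rectangles, and it
   remains to see that it covers almost all of S.
   Call a row or column of a square Q of side delta full, empty or impure when
   ~S, S or neither is null on it.  The impure lines are detected by difference
   quotients, and a Vitali covering bounds their measure by 15 p, where p is the
   perimeter of S in Q.  If almost no row is full, then |Q /\ S| <= 15 delta p.
   Otherwise almost no column is empty, hence (unless delta <= 60 p) almost every
   line is full or impure, and generic full lines within about 15 p of the sides
   bound a rectangle of zero trace.  In all cases at most 60 delta p of Q /\ S
   remains uncovered.  As p is superadditive, summing over the dyadic
   subdivisions of a fixed square lets delta go to 0. *)

Set Implicit Arguments.
Unset Strict Implicit.
Unset Printing Implicit Defensive.

Local Open Scope classical_set_scope.
Local Open Scope ring_scope.

(** * Borel sets and null sets of the plane *)

(** The perimeter is available only as a supremum of fluxes, so each geometric statement becomes the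
    choice of a test field. Gluing two fields across the boundary of a rectangle costs the measure
    of the component in a layer of width $r$ times a gradient of order $1/r$. Zero trace must
    therefore mean that this measure is $o(r)$; that the four sides are full lines would not be
    enough. This is why the sides are taken at Lebesgue points of the function giving the length of
    the complement of S on each line: at such a point with value zero, the average over nearby lines
    tends to zero. The square estimate pairs one factor delta with the perimeter: a subdivision
    halves the first and does not increase the sum of the second, whereas a bound by the area would
    gain nothing. The constant 60 is 4 times 15, for four margins of width about 15 p and length
    delta. Slicing calls for Borel sets, while S and the components of its complement are only
    Lebesgue measurable. Hence the lines are studied on a Borel version of S and the cutting is done
    on the components themselves; the two arguments meet only in measures of sets, where null sets
    do not count. *)

Section Borel.
Context {R : realType}.
Notation mu := (@lebesgue_measure R).
Notation mu2 := (mu \x mu)%E.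
Notation L2 := (@lebesgue2 R).

Lemma itv_box_nbhs (x : R * R) (U : set (R * R)) : nbhs x U ->
  exists2 e : R, 0 < e & `]x.1 - e, x.1 + e[ `*` `]x.2 - e, x.2 + e[ `<=` U.
Proof.
move=> /nbhs_ballP[e /= e0 xeU]; exists e => // y [/=].
rewrite !in_itv/= => y1 y2; apply: xeU; split; rewrite /ball/= ltr_norml; lra.
Qed.

(** Countably many boxes suffice: this makes open sets Borel, and later lets real boxes be replaced
    by the rational ones of [essential_interior]. *)
Lemma open_rat_boxes (U : set (R * R)) : open U ->
  U = \bigcup_(q in [set q : (rat * rat) * (rat * rat) |
       `]ratr q.1.1, ratr q.1.2[ `*` `]ratr q.2.1, ratr q.2.2[ `<=` U])
       (`]ratr q.1.1, ratr q.1.2[%classic `*` `]ratr q.2.1, ratr q.2.2[%classic).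
Proof.
move=> oU; apply/seteqP; split; last by move=> x [q qU] /qU.
move=> x Ux; have /itv_box_nbhs[e e0 xeU] : nbhs x U by exact: open_nbhs_nbhs.
have [|a] := @rat_in_itvoo R (x.1 - e) x.1; first by lra.
have [|b] := @rat_in_itvoo R x.1 (x.1 + e); first by lra.
have [|c] := @rat_in_itvoo R (x.2 - e) x.2; first by lra.
have [|d] := @rat_in_itvoo R x.2 (x.2 + e); first by lra.
rewrite !in_itv/= => /andP[d1 d2] /andP[c1 c2] /andP[b1 b2] /andP[a1 a2].
exists ((a, b), (c, d)) => /=; last by rewrite /= !in_itv/= a2 b1 c2 d1.
by move=> y; rewrite /= !in_itv/= => -[/andP[? ?] /andP[? ?]]; apply: xeU;
   rewrite /= !in_itv/=; split; lra.
Qed.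

Lemma open_measurable_plane (U : set (R * R)) : open U -> measurable U.
Proof.
move=> /open_rat_boxes ->; rewrite bigcup_mkcond.
apply: countable_bigcupT_measurable => [|q]; first exact: countableP.
by case: ifP => // _; exact: measurableX.
Qed.

Lemma continuous_measurable_plane (f : R * R -> R) :
  continuous f -> measurable_fun setT f.
Proof.
move=> /continuousP cf; apply: (measurability _ (measurable_realfun.RGenOpens.measurableE R)).
move=> _ [_ [a [b ->] <-]]; rewrite setTI.
by apply: open_measurable_plane; exact: (cf _ (interval_open _ _)).
Qed.

Lemma lebesgue2_measurable_borel (B : set (R * R)) : measurable B ->
  lebesgue2_measurable B.
Proof. by move=> mB; exact (caratheodory_measurable_mu_ext mu2 mB). Qed.

Lemma lebesgue2E (B : set (R * R)) : measurable B -> L2 B = mu2 B.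
Proof. by move=> mB; exact (measurable_mu_extE mu2 mB). Qed.

Lemma le_lebesgue2 (A B : set (R * R)) : A `<=` B -> (L2 A <= L2 B)%E.
Proof. by move=> AB; exact: (le_outer_measure (mu2^*)%mu). Qed.

Lemma lebesgue2_ge0 (A : set (R * R)) : (0 <= L2 A)%E.
Proof. exact: (outer_measure_ge0 (mu2^*)%mu). Qed.

Lemma lebesgue20 : L2 set0 = 0%E.
Proof. exact: (outer_measure0 (mu2^*)%mu). Qed.

Lemma lebesgue2U (A B : set (R * R)) : (L2 (A `|` B) <= L2 A + L2 B)%E.
Proof. exact: (outer_measureU2 (mu2^*)%mu). Qed.

Lemma lebesgue2_null_measurable (N : set (R * R)) : L2 N = 0%E ->
  lebesgue2_measurable N.
Proof.
move=> N0; apply: le_caratheodory_measurable => X.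
change (L2 (X `&` N) + L2 (X `&` ~` N) <= L2 X)%E.
rewrite (_ : L2 (X `&` N) = 0%E) ?add0e ?le_lebesgue2//.
by apply/eqP; rewrite eq_le lebesgue2_ge0 andbT -N0 le_lebesgue2.
Qed.

Lemma lebesgue2_null_sub (A B : set (R * R)) : A `<=` B -> L2 B = 0%E -> L2 A = 0%E.
Proof.
by move=> AB B0; apply/eqP; rewrite eq_le lebesgue2_ge0 andbT -B0 le_lebesgue2.
Qed.

Lemma lebesgue2_null_bigcup I (D : set I) (F : I -> set (R * R)) :
  countable D -> (forall i, D i -> L2 (F i) = 0%E) ->
  L2 (\bigcup_(i in D) F i) = 0%E.
Proof.
move=> /countable_injP[f finj] F0.
pose G n := \bigcup_(i in D `&` f @^-1` [set n]) F i.
have G0 n : L2 (G n) = 0%E.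
  have [[i [Di fi]]|nex] := pselect (exists i, D i /\ f i = n).
    apply: (lebesgue2_null_sub _ (F0 _ Di)) => x [j [Dj /= fj] Fjx].
    by rewrite (finj i j) ?inE// fi fj.
  rewrite (_ : G n = set0) ?outer_measure0//.
  by rewrite -subset0 => x [i [Di fi] _]; apply: nex; exists i.
apply: (@lebesgue2_null_sub _ (\bigcup_n G n)).
  by move=> x [i Di Fix]; exists (f i) => //; exists i.
apply/eqP; rewrite eq_le lebesgue2_ge0 andbT.
apply: le_trans (outer_measure_sigma_subadditive (mu2^*)%mu _) _.
by rewrite eseries0// => n _ _; exact: G0.
Qed.

Lemma lebesgue2_nullU (A B : set (R * R)) : L2 A = 0%E -> L2 B = 0%E ->
  L2 (A `|` B) = 0%E.
Proof.
move=> A0 B0; apply/eqP; rewrite eq_le lebesgue2_ge0 andbT.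
by rewrite (le_trans (lebesgue2U _ _))// A0 B0 adde0.
Qed.

(** The outer measure is an infimum over countable covers by Borel sets; intersecting covers that
    are optimal up to $1/(n+1)$ gives a Borel hull. *)
Lemma lebesgue2_outer_regular (X : set (R * R)) : (L2 X < +oo)%E ->
  exists B, [/\ measurable B, X `<=` B & L2 B = L2 X].
Proof.
move=> Xoo; have Xfin : L2 X \is a fin_num by rewrite ge0_fin_numE ?lebesgue2_ge0.
have near n : exists B, [/\ measurable B, X `<=` B & (L2 B <= L2 X + (n.+1%:R^-1)%:E)%E].
  have n0 : (0 < (n.+1%:R^-1 : R))%R by rewrite invr_gt0.
  have [_ [F [mF XF] <-] Flt] := lb_ereal_inf_adherent n0 (Xfin : ereal_inf _ \is a fin_num).
  exists (\bigcup_k F k); split => //; first exact: bigcupT_measurable.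
  apply: le_trans (ltW Flt).
  apply: le_trans (outer_measure_sigma_subadditive (mu2^*)%mu _) _.
  apply: lee_nneseries => [k _ _|k _]; first exact: outer_measure_ge0.
  apply: (@le_trans _ _ (L2 (F k))) => //; rewrite le_eqVlt; apply/orP; left; apply/eqP.
  exact (lebesgue2E (mF k)).
move/choice: near => [B /all_and3[mB XB LB]].
exists (\bigcap_n B n); split; first exact: bigcapT_measurable.
  by move=> x Xx n _; exact: XB.
apply/eqP; rewrite eq_le; apply/andP; split; last first.
  by apply: le_lebesgue2 => x Xx n _; exact: XB.
apply/lee_addgt0Pr => e e0.
near \oo => n.
apply: (@le_trans _ _ (L2 (B n))); first by apply: le_lebesgue2; exact: bigcap_inf.
apply: le_trans (LB n) _; rewrite leeD2l// lee_fin ltW//.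
by near: n; exact: near_infty_natSinv_lt (PosNum e0).
Unshelve. all: by end_near. Qed.

(** Slices of a merely Lebesgue measurable set need not be measurable, so the slicing is run on a
    Borel version. On each box [K n] a Borel hull of the trace of [E] exceeds it by a null set,
    because finite measures cancel in the Caratheodory identity. *)
Lemma lebesgue2_borel_version (E : set (R * R)) : lebesgue2_measurable E ->
  exists2 B, measurable B & L2 (E `+` B) = 0%E.
Proof.
move=> mE.
pose K n : set (R * R) := (`]- n%:R, n%:R[ `*` `]- n%:R, n%:R[)%classic.
have mK n : measurable (K n) by exact: measurableX.
have near n : exists B, [/\ measurable B, E `&` K n `<=` B & L2 (B `\` E) = 0%E].
  have Koo : (L2 (K n) < +oo)%E.
    rewrite lebesgue2E ?product_measure1E//= !lebesgue_measure_itv/=.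
    by case: ifP => _; rewrite ?mul0e// -EFinM ltry.
  have Xoo : (L2 (E `&` K n) < +oo)%E.
    by apply: le_lt_trans Koo; apply: le_lebesgue2; exact: subIsetr.
  have [B [mB EB BE]] := lebesgue2_outer_regular Xoo.
  have BK : L2 (B `\` (E `&` K n)) = 0%E.
    have mEK : lebesgue2_measurable (E `&` K n).
      by apply: caratheodory_measurable_setI => //; exact: lebesgue2_measurable_borel.
    have : L2 B = (L2 (B `&` (E `&` K n)) + L2 (B `&` ~` (E `&` K n)))%E := mEK B.
    rewrite (setIidr EB) -setDE BE => h.
    apply/eqP; rewrite eq_le lebesgue2_ge0 andbT -(leeD2lE (x := L2 (E `&` K n))).
      by rewrite -h adde0.
    by rewrite ge0_fin_numE ?lebesgue2_ge0.
  exists (B `&` K n); split => [||].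
  - exact: measurableI.
  - by move=> x [Ex Kx]; split => //; apply: EB.
  - by apply: lebesgue2_null_sub BK => x [[Bx Kx] nEx]; split => // -[].
move/choice: near => [B /all_and3[mB XB LB]].
exists (\bigcup_n B n); first exact: bigcupT_measurable.
have EB : E `<=` \bigcup_n B n.
  move=> x Ex; have [n xn] : exists n, K n x.
    near \oo => n; exists n; rewrite /K/= !in_itv/= -!ltr_norml; split.
      near: n; exact: nbhs_infty_gtr.
    near: n; exact: nbhs_infty_gtr.
  by exists n => //; exact: XB.
have ED : E `\` \bigcup_n B n = set0 by rewrite setD_eq0.
rewrite setY_def ED set0U setD_bigcupl.
by apply: lebesgue2_null_bigcup.
Unshelve. all: by end_near. Qed.

End Borel.

(** * Integrals of bounded functions on sets of finite measure *)

Section bounded_support.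
Context d (T : measurableType d) (R : realType) (m : {measure set T -> \bar R}).
Implicit Types (D E F : set T) (f : T -> R).

Lemma integrable_bounded_support D F f (M : R) :
  measurable D -> measurable F -> (m F < +oo)%E -> measurable_fun setT f ->
  (forall x, F x -> `|f x| <= M) -> (forall x, ~ F x -> f x = 0) ->
  m.-integrable D (EFin \o f).
Proof.
move=> mD mF Foo mf fM f0.
suff : m.-integrable setT (EFin \o f) by apply: integrableS.
rewrite (_ : EFin \o f = (EFin \o f) \_ F); last first.
  apply/funext => x; rewrite patchE; case: ifPn => //.
  by rewrite notin_setE => /f0 /= ->.
rewrite -integrable_mkcond//; apply: measurable_bounded_integrable => //.
  exact: measurable_funTS.
exists M; split; first exact: num_real.
by move=> y My x /fM fxM; apply: le_trans fxM _; exact: ltW.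
Qed.

Lemma Rintegral_splitD E F f : measurable E -> measurable F ->
  m.-integrable E (EFin \o f) ->
  \int[m]_(x in E) f x = \int[m]_(x in E `&` F) f x + \int[m]_(x in E `\` F) f x.
Proof.
move=> mE mF intf; rewrite -Rintegral_setU//.
- by rewrite setUIDK.
- exact: measurableI.
- exact: measurableD.
- by rewrite setUIDK.
- by rewrite disj_set2E setDE setIACA setICr setI0.
Qed.

Lemma le_normr_Rintegral_bound E f (M : R) : measurable E -> (m E < +oo)%E ->
  measurable_fun setT f -> (forall x, E x -> `|f x| <= M) ->
  `|\int[m]_(x in E) f x| <= M * fine (m E).
Proof.
move=> mE Eoo mf fM.
have intf : m.-integrable E (EFin \o f).
  apply: measurable_bounded_integrable => //; first exact: measurable_funTS.
  exists M; split; first exact: num_real.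
  by move=> y My x /fM fxM; apply: le_trans fxM _; exact: ltW.
rewrite (le_trans (le_normr_Rintegral _ _))//.
rewrite -Rintegral_cst//; apply: le_Rintegral => //.
  exact: integrable_norm.
apply: measurable_bounded_integrable => //.
exists `|M|; split; first exact: num_real.
by move=> y My x _ /=; rewrite ltW.
Qed.

Lemma Rintegral_null E f : measurable E -> m E = 0%E -> measurable_fun setT f ->
  \int[m]_(x in E) f x = 0.
Proof.
move=> mE E0 mf; rewrite /Rintegral null_set_integral//.
by apply/measurable_EFinP; exact: measurable_funTS.
Qed.

End bounded_support.

(** * Transfer of integrals between the product measure and its completion *)

Section IntL2.
Context {R : realType}.
Notation mu := (@lebesgue_measure R).
Notation mu2 := (mu \x mu)%E.
Notation L2 := (@lebesgue2 R).
Notation ct := (caratheodory_type (mu2^*)%mu).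
Notation plane := (measurableTypeR R * measurableTypeR R)%type.

(** The two integrals live on different measurable types: [ct] carries the Caratheodory measurable
    sets, [plane] only the product sigma-algebra. The identity is measurable from the first to the
    second, and pushing [L2] forward along it gives back the product measure, hence Fubini for Borel
    integrands. *)
Lemma measurable_fun_ct_id : measurable_fun setT (idfun : ct -> plane).
Proof.
by move=> _ B mB; rewrite setTI; exact: lebesgue2_measurable_borel.
Qed.

Lemma measurable_fun_ct d (T : sigmaRingType d) (f : R * R -> T) :
  measurable_fun setT f -> measurable_fun [set: ct] (f : ct -> T).
Proof.
move=> mf _ B mB; rewrite setTI; apply: lebesgue2_measurable_borel.
by rewrite -[X in measurable X]setTI; exact: mf.
Qed.

Let pushL2 : {measure set plane -> \bar R} :=
  measure_function_pushforward__canonical__measure_function_Measure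
    L2 measurable_fun_ct_id.

Lemma ge0_integral_lebesgue2 (B : set (R * R)) (f : R * R -> \bar R) :
  measurable B -> measurable_fun setT f -> (forall x, 0 <= f x)%E ->
  (\int[L2]_(x in B) f x = \int[mu2]_(x in B) f x)%E.
Proof.
move=> mB mf f0.
have := @ge0_integral_pushforward _ _ ct plane R idfun measurable_fun_ct_id L2 B f mB.
move=> /(_ (measurable_funTS mf)) /= <- //.
by apply: (eq_measure_integral _ (m1 := pushL2)) => A mA _; exact (lebesgue2E mA).
Qed.

Lemma integrable_lebesgue2 (f : R * R -> \bar R) :
  mu2.-integrable setT f -> L2.-integrable [set: ct] f.
Proof.
move=> /integrableP[mf foo]; apply/integrableP; split; first exact: measurable_fun_ct.
rewrite ge0_integral_lebesgue2//; exact: measurableT_comp.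
Qed.

Lemma integral_lebesgue2 (f : R * R -> \bar R) :
  mu2.-integrable setT f ->
  (\int[L2]_x f x = \int[mu2]_x f x)%E.
Proof.
move=> intf; have /integrableP[mf _] := intf.
have := @integral_pushforward _ _ ct plane R idfun measurable_fun_ct_id L2 setT f mf.
move=> /(_ _ measurableT) /= <- //.
  by apply: (eq_measure_integral _ (m1 := pushL2)) => A mA _; exact (lebesgue2E mA).
exact: integrable_lebesgue2.
Qed.

Lemma lebesgue2_box (a b c d : R) : a <= b -> c <= d ->
  L2 (`]a, b[ `*` `]c, d[) = ((b - a) * (d - c))%:E.
Proof.
move=> ab cd; rewrite lebesgue2E; last exact: measurableX.
rewrite product_measure1E//= !lebesgue_measure_itv/= !lte_fin.
case: ifPn => [_|]; last by rewrite -leNgt => ba; rewrite mul0e (_ : b - a = 0) ?mul0r//; lra.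
case: ifPn => [_|]; last by rewrite -leNgt => ba; rewrite mule0 (_ : d - c = 0) ?mulr0//; lra.
by rewrite EFinM !EFinB.
Qed.

Definition boxn (r : R) : set (R * R) := (`]- r, r[ `*` `]- r, r[)%classic.

Lemma lebesgue2_boxn_lty r : (L2 (boxn r) < +oo)%E.
Proof.
have [r0|r0] := leP 0 r.
  by rewrite lebesgue2_box ?ltry//; lra.
rewrite (_ : boxn r = set0) ?lebesgue20//.
by rewrite -subset0 => x []/=; rewrite !in_itv/=; lra.
Qed.

Lemma lebesgue2_measurable_boxn r : lebesgue2_measurable (boxn r).
Proof. by apply: lebesgue2_measurable_borel; exact: measurableX. Qed.

Lemma Rintegral_lebesgue2_eq (E E' : set (R * R)) (f : R * R -> R) :
  lebesgue2_measurable E -> lebesgue2_measurable E' -> L2 (E `+` E') = 0%E ->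
  measurable_fun setT f -> L2.-integrable [set: ct] (EFin \o f) ->
  \int[L2]_(x in E) f x = \int[L2]_(x in E') f x.
Proof.
move=> mE mE' EE' mf intf; have mf' := measurable_fun_ct mf.
rewrite (@Rintegral_splitD _ ct _ L2 E E')//; last exact: integrableS intf.
rewrite [RHS](@Rintegral_splitD _ ct _ L2 E' E)//; last exact: integrableS intf.
rewrite setIC; congr (_ + _).
rewrite !(@Rintegral_null _ ct _ L2)//.
- exact: measurableD.
- by apply: lebesgue2_null_sub EE'; rewrite setY_def; exact: subsetUr.
- exact: measurableD.
- by apply: lebesgue2_null_sub EE'; rewrite setY_def; exact: subsetUl.
Qed.

End IntL2.

(** * Calculus of C^1 functions *)

Section C1.
Context {R : realType}.
Implicit Types (u w : R * R -> R) (f g : R -> R) (phi : R * R -> R * R).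

(** The scalar counterpart of [continuously_differentiable], for the components of a field and for
    the cutoffs that multiply them. *)
Definition C1fun u := (forall x, differentiable u x) /\
  (forall v, continuous (fun x => 'D_v u x)).

Lemma C1fun_continuous u : C1fun u -> continuous u.
Proof. by move=> [du _] x; exact: differentiable_continuous. Qed.

Lemma derive_pairE u w x v : differentiable u x -> differentiable w x ->
  'D_v (fun y => (u y, w y)) x = ('D_v u x, 'D_v w x).
Proof.
move=> du dw; rewrite !deriveE//; last exact: differentiable_pair.
by rewrite diff_pair.
Qed.

Lemma C1fun_pair u w : C1fun u -> C1fun w ->
  continuously_differentiable (fun x => (u x, w x)).
Proof.
move=> [du cu] [dw cw]; split => [x|v]; first exact: differentiable_pair.
rewrite (_ : (fun x => _) = fun x => ('D_v u x, 'D_v w x)); last first.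
  by apply/funext => x; rewrite derive_pairE.
move=> x; exact: (cvg_pair (cu v x) (cw v x)).
Qed.

Lemma differentiable_fst (x : R * R) : differentiable (fst : R * R -> R) x.
Proof. by apply: linear_differentiable => y; exact: cvg_fst. Qed.

Lemma differentiable_snd (x : R * R) : differentiable (snd : R * R -> R) x.
Proof. by apply: linear_differentiable => y; exact: cvg_snd. Qed.

Lemma derive_fst_comp phi x v : differentiable phi x ->
  'D_v (fun y => (phi y).1) x = ('D_v phi x).1.
Proof.
move=> dphi; rewrite !deriveE//; last first.
  exact: (differentiable_comp dphi (differentiable_fst _)).
rewrite (@diff_comp _ _ _ _ phi (fst : R * R -> R))//=; last exact: differentiable_fst.
by rewrite diff_lin// => y; exact: cvg_fst.
Qed.

Lemma derive_snd_comp phi x v : differentiable phi x ->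
  'D_v (fun y => (phi y).2) x = ('D_v phi x).2.
Proof.
move=> dphi; rewrite !deriveE//; last first.
  exact: (differentiable_comp dphi (differentiable_snd _)).
rewrite (@diff_comp _ _ _ _ phi (snd : R * R -> R))//=; last exact: differentiable_snd.
by rewrite diff_lin// => y; exact: cvg_snd.
Qed.

Lemma C1fun_fst phi : continuously_differentiable phi -> C1fun (fun x => (phi x).1).
Proof.
move=> [dphi cphi]; split => [x|v].
  exact: (differentiable_comp (dphi x) (differentiable_fst _)).
rewrite (_ : (fun x => _) = fun x => ('D_v phi x).1); last first.
  by apply/funext => x; rewrite derive_fst_comp.
by move=> x; apply: (continuous_comp (cphi v x)); exact: cvg_fst.
Qed.

Lemma C1fun_snd phi : continuously_differentiable phi -> C1fun (fun x => (phi x).2).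
Proof.
move=> [dphi cphi]; split => [x|v].
  exact: (differentiable_comp (dphi x) (differentiable_snd _)).
rewrite (_ : (fun x => _) = fun x => ('D_v phi x).2); last first.
  by apply/funext => x; rewrite derive_snd_comp.
by move=> x; apply: (continuous_comp (cphi v x)); exact: cvg_snd.
Qed.

Lemma div2E phi x : differentiable phi x ->
  div2 phi x = 'D_(1, 0) (fun y => (phi y).1) x + 'D_(0, 1) (fun y => (phi y).2) x.
Proof. by move=> dphi; rewrite /div2 derive_fst_comp// derive_snd_comp. Qed.

Lemma C1funD u w : C1fun u -> C1fun w -> C1fun (fun x => u x + w x).
Proof.
move=> [du cu] [dw cw]; split => [x|v]; first exact: differentiableD.
rewrite (_ : (fun x => _) = fun x => 'D_v u x + 'D_v w x); last first.
  by apply/funext => x; rewrite deriveD//; exact: diff_derivable.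
by move=> x; apply: cvgD; [exact: cu|exact: cw].
Qed.

Lemma deriveMC1 u w x v : C1fun u -> C1fun w ->
  'D_v (fun x => u x * w x) x = u x * 'D_v w x + w x * 'D_v u x.
Proof.
by move=> [du cu] [dw cw]; rewrite deriveM//; exact: diff_derivable.
Qed.

Lemma deriveDC1 u w x v : C1fun u -> C1fun w ->
  'D_v (fun x => u x + w x) x = 'D_v u x + 'D_v w x.
Proof.
by move=> [du cu] [dw cw]; rewrite deriveD//; exact: diff_derivable.
Qed.

Lemma C1funM u w : C1fun u -> C1fun w -> C1fun (fun x => u x * w x).
Proof.
move=> Cu Cw; split => [x|v]; first by apply: differentiableM; [exact: Cu.1|exact: Cw.1].
rewrite (_ : 'D_v _ = fun x => u x * 'D_v w x + w x * 'D_v u x); last first.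
  by apply/funext => x; exact: deriveMC1.
move=> x; apply: cvgD; apply: cvgM.
- exact: C1fun_continuous.
- exact: Cw.2.
- exact: C1fun_continuous.
- exact: Cu.2.
Qed.

Lemma C1fun_cst (c : R) : C1fun (fun=> c).
Proof.
split => [x|v]; first exact: differentiable_cst.
rewrite (_ : 'D_v _ = fun x => 0); first by move=> x; exact: cvg_cst.
by apply/funext => x; exact: derive_cst.
Qed.

(** The derivative is carried as an explicit function, so that bounds and supports of the
    derivatives of cutoffs are read off closed formulas. *)
Definition C1line f f' := (forall x : R, is_derive x 1 f (f' x)) /\ continuous f'.

Lemma C1line_diff f f' x : C1line f f' -> differentiable f x.
Proof. by move=> [df _]; apply/derivable1_diffP; have [] := df x. Qed.

Lemma C1line_continuous f f' : C1line f f' -> continuous f.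
Proof. by move=> Cf x; apply: differentiable_continuous; exact: C1line_diff Cf. Qed.

Lemma C1line_derive f f' x v : C1line f f' -> 'd f x v = v * f' x.
Proof.
move=> Cf; have [df _] := Cf; rewrite diff1E; last exact: C1line_diff Cf.
by rewrite derive1E; have -> := @derive_val _ _ _ _ _ _ _ (df x).
Qed.

Lemma derive_comp_fst f f' x (v : R * R) : C1line f f' ->
  'D_v (fun y : R * R => f y.1) x = v.1 * f' x.1.
Proof.
move=> Cf; have dfx := C1line_diff x.1 Cf.
rewrite deriveE; last exact: (differentiable_comp (differentiable_fst x) dfx).
rewrite (@diff_comp _ _ _ _ (fst : R * R -> R) f)//=; last exact: differentiable_fst.
rewrite (C1line_derive _ _ Cf) diff_lin// => y; exact: cvg_fst.
Qed.

Lemma derive_comp_snd f f' x (v : R * R) : C1line f f' ->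
  'D_v (fun y : R * R => f y.2) x = v.2 * f' x.2.
Proof.
move=> Cf; have dfx := C1line_diff x.2 Cf.
rewrite deriveE; last exact: (differentiable_comp (differentiable_snd x) dfx).
rewrite (@diff_comp _ _ _ _ (snd : R * R -> R) f)//=; last exact: differentiable_snd.
rewrite (C1line_derive _ _ Cf) diff_lin// => y; exact: cvg_snd.
Qed.

Lemma C1fun_comp_fst f f' : C1line f f' -> C1fun (fun y : R * R => f y.1).
Proof.
move=> Cf; split => [x|v].
  exact: (differentiable_comp (differentiable_fst x) (C1line_diff x.1 Cf)).
rewrite (_ : 'D_v _ = fun x : R * R => v.1 * f' x.1); last first.
  by apply/funext => x; exact: derive_comp_fst.
move=> x; apply: cvgM; first exact: cvg_cst.
by apply: (@cvg_comp _ _ _ fst f'); [exact: cvg_fst|exact: Cf.2].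
Qed.

Lemma C1fun_comp_snd f f' : C1line f f' -> C1fun (fun y : R * R => f y.2).
Proof.
move=> Cf; split => [x|v].
  exact: (differentiable_comp (differentiable_snd x) (C1line_diff x.2 Cf)).
rewrite (_ : 'D_v _ = fun x : R * R => v.2 * f' x.2); last first.
  by apply/funext => x; exact: derive_comp_snd.
move=> x; apply: cvgM; first exact: cvg_cst.
by apply: (@cvg_comp _ _ _ snd f'); [exact: cvg_snd|exact: Cf.2].
Qed.

End C1.

(** * Cutoff functions of class $C^1$ on the line *)

Section step.
Context {R : realType}.

(** A truncated power: the square of the positive part is $C^1$ and vanishes on a half line. Test
    fields only have to be $C^1$, so combinations of its translates are smooth enough. *)
Definition posq (x : R) : R := Num.max x 0 ^+ 2.

(** The remainder is at most $h^2$ at every point, including the kink of the derivative, so one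
    estimate gives differentiability everywhere. *)
Lemma posq_expansion (x h : R) :
  `|posq (x + h) - posq x - h * (2 * Num.max x 0)| <= h ^+ 2.
Proof.
rewrite /posq ler_norml; case: (leP x 0) => x0; case: (leP (x + h) 0) => xh0.
- by apply/andP; split; nra.
- by apply/andP; split; nra.
- by apply/andP; split; nra.
- by apply/andP; split; nra.
Qed.

Lemma is_derive_posq (x : R) : is_derive x 1 posq (2 * Num.max x 0).
Proof.
suff H : h^-1 *: (posq (h *: (1 : R) + x) - posq x) @[h --> 0^'] --> 2 * Num.max x 0.
  by apply: DeriveDef; [apply: (cvgP _ H)|exact: (cvg_lim _ H)].
apply/cvgrPdist_le => e e0; near=> h.
have h0 : h != 0 by near: h; exact: nbhs_dnbhs_neq.
rewrite distrC /GRing.scale/= mulr1 (addrC h).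
have -> : h^-1 * (posq (x + h) - posq x) - 2 * Num.max x 0 =
  h^-1 * (posq (x + h) - posq x - h * (2 * Num.max x 0)) by field.
rewrite normrM normfV ler_pdivrMl ?normr_gt0// (le_trans (posq_expansion _ _))//.
rewrite -normr_id -[h ^+ 2]ger0_norm ?sqr_ge0// normrX normr_id expr2.
rewrite ler_wpM2l//; near: h; exact: dnbhs0_le.
Unshelve. all: by end_near. Qed.

Lemma continuous_max0 : continuous (fun x : R => Num.max x 0).
Proof. by move=> x; apply: continuous_max => //; exact: cvg_cst. Qed.

Lemma C1line_posq : C1line posq (fun x => 2 * Num.max x 0).
Proof.
split; first exact: is_derive_posq.
by move=> x; apply: cvgM; [exact: cvg_cst|exact: continuous_max0].
Qed.

Lemma C1lineD (f f' g g' : R -> R) : C1line f f' -> C1line g g' ->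
  C1line (fun x => f x + g x) (fun x => f' x + g' x).
Proof.
move=> [df cf] [dg cg]; split => [x|x]; first exact: is_deriveD.
by apply: cvgD; [exact: cf|exact: cg].
Qed.

Lemma C1lineZ (c : R) (f f' : R -> R) : C1line f f' ->
  C1line (fun x => c * f x) (fun x => c * f' x).
Proof.
move=> [df cf]; split => [x|x]; first exact: is_deriveZ.
by apply: cvgM; [exact: cvg_cst|exact: cf].
Qed.

Lemma C1line_affine (a b : R) (f f' : R -> R) : C1line f f' ->
  C1line (fun x => f ((x - a) * b)) (fun x => f' ((x - a) * b) * b).
Proof.
have caff (x : R) : (fun x : R => (x - a) * b) @ x --> (x - a) * b.
  by apply: cvgM; [apply: cvgB => //; exact: cvg_cst|exact: cvg_cst].
move=> [df cf]; split => [x|x].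
  apply: (@is_derive1_comp _ f (fun x => (x - a) * b)).
  apply: is_derive_eq.
  by rewrite /GRing.scale/= subr0 mulr1 mulr0 add0r.
apply: cvgM; last exact: cvg_cst.
by apply: (@cvg_comp _ _ _ (fun x => (x - a) * b) f'); [exact: caff|exact: cf].
Qed.

(* The derivative of sigma is the tent function of height 2 on [0, 1]. *)
Definition sigma (x : R) := 2 * posq ((x - 0) * 1) +
  (- 4 * posq ((x - 2^-1) * 1) + 2 * posq ((x - 1) * 1)).
Definition dsigma (x : R) := 2 * (2 * Num.max ((x - 0) * 1) 0 * 1) +
  (- 4 * (2 * Num.max ((x - 2^-1) * 1) 0 * 1) + 2 * (2 * Num.max ((x - 1) * 1) 0 * 1)).

Lemma C1line_sigma : C1line sigma dsigma.
Proof.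
(* The unsimplified [- 0] and [* 1] in [sigma] and [dsigma] make both functions match literally what
   the closure lemmas produce. *)
by do ![apply: C1lineD|apply: C1lineZ]; exact: (C1line_affine _ _ C1line_posq).
Qed.

Lemma sigma_le0 (x : R) : x <= 0 -> sigma x = 0.
Proof.
move=> x0; rewrite /sigma /posq !mulr1 !max_r; [|lra..].
by rewrite !expr0n/= !mulr0 !addr0.
Qed.

Lemma sigma_ge1 (x : R) : 1 <= x -> sigma x = 1.
Proof. by move=> x0; rewrite /sigma /posq !mulr1 !max_l; [field|lra..]. Qed.

Lemma sigma01 (x : R) : 0 <= sigma x <= 1.
Proof.
have [x0|x0] := leP x 0; first by rewrite sigma_le0// lexx/=.
have [x1|x1] := leP 1 x; first by rewrite sigma_ge1// lexx/= ler01.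
rewrite /sigma /posq !mulr1 (max_l (ltW _)) ?subr0// (@max_r _ _ (x - 1)); last lra.
by case: (leP (x - 2^-1) 0) => x2; apply/andP; split; nra.
Qed.

Lemma dsigma02 (x : R) : 0 <= dsigma x <= 2.
Proof.
rewrite /dsigma !mulr1 subr0.
by case: (leP x 0) => ?; case: (leP (x - 2^-1) 0) => ?; case: (leP (x - 1) 0) => ?;
  apply/andP; split; lra.
Qed.

Lemma dsigma_out (x : R) : x <= 0 \/ 1 <= x -> dsigma x = 0.
Proof.
rewrite /dsigma !mulr1 subr0.
by case: (leP x 0) => ?; case: (leP (x - 2^-1) 0) => ?; case: (leP (x - 1) 0) => ?;
  move=> [?|?]; lra.
Qed.

(** Two uses: [step] builds the cutoffs, and its derivative [dstep] is a probability density on ]p,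
    q[ bounded by 2 / (q - p), that is, a smoothed average over this interval. *)
Definition step (p q x : R) := sigma ((x - p) * (q - p)^-1).
Definition dstep (p q x : R) := dsigma ((x - p) * (q - p)^-1) * (q - p)^-1.

Lemma C1line_step p q : C1line (step p q) (dstep p q).
Proof. exact: C1line_affine C1line_sigma. Qed.

Lemma step01 p q x : 0 <= step p q x <= 1.
Proof. exact: sigma01. Qed.

Lemma step_le p q x : p < q -> x <= p -> step p q x = 0.
Proof.
by move=> pq xp; apply: sigma_le0; rewrite mulr_le0_ge0 ?invr_ge0; lra.
Qed.

Lemma step_ge p q x : p < q -> q <= x -> step p q x = 1.
Proof.
by move=> pq xp; apply: sigma_ge1; rewrite ler_pdivlMr; lra.
Qed.

Lemma dstep_bound p q x : p < q -> 0 <= dstep p q x <= 2 / (q - p).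
Proof.
move=> pq; have /andP[d0 d2] := dsigma02 ((x - p) * (q - p)^-1).
rewrite /dstep mulr_ge0 ?invr_ge0//=; last lra.
by rewrite ler_wpM2r// invr_ge0; lra.
Qed.

Lemma dstep_out p q x : p < q -> ~ (`]p, q[%classic x) -> dstep p q x = 0.
Proof.
move=> pq xpq; rewrite /dstep dsigma_out ?mul0r//.
have [xp|xp] := leP x p; first by left; rewrite mulr_le0_ge0 ?invr_ge0; lra.
right; rewrite ler_pdivlMr ?mul1r; last lra.
by rewrite lerD2r leNgt; apply/negP => xq; apply: xpq; rewrite /= in_itv/= xp.
Qed.

Lemma continuous_dstep p q : continuous (dstep p q).
Proof. exact: (C1line_step p q).2. Qed.

Lemma measurable_dstep p q : measurable_fun setT (dstep p q).
Proof. by apply: continuous_measurable_fun; exact: continuous_dstep. Qed.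

Lemma Rintegral_dstep p q : p < q ->
  \int[@lebesgue_measure R]_(x in `[p, q]) dstep p q x = 1.
Proof.
move=> pq; rewrite /Rintegral (@continuous_FTC2 _ _ (step p q))//.
- by rewrite step_ge// step_le//= subr0.
- by apply: continuous_subspaceT; exact: continuous_dstep.
- have [dst _] := C1line_step p q.
  have cst := C1line_continuous (C1line_step p q).
  by split; [move=> x _; case: (dst x)|apply: cvg_at_right_filter; exact: cst|
             apply: cvg_at_left_filter; exact: cst].
- by move=> x _; rewrite derive1E; case: ((C1line_step p q).1 x).
Qed.

Definition trap (a b r x : R) := step a (a + r) x + - 1 * step (b - r) b x.
Definition dtrap (a b r x : R) := dstep a (a + r) x + - 1 * dstep (b - r) b x.

Lemma C1line_trap a b r : C1line (trap a b r) (dtrap a b r).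
Proof. by apply: C1lineD; last apply: C1lineZ; exact: C1line_step. Qed.

Lemma trap01 a b r x : 0 < r -> a + r <= b - r -> 0 <= trap a b r x <= 1.
Proof.
move=> r0 ab; rewrite /trap mulN1r.
have [xar|xar] := leP x (a + r).
  rewrite (@step_le (b - r)) ?subr0 ?step01//; lra.
rewrite (@step_ge a); [|lra..].
have := step01 (b - r) b x; lra.
Qed.

Lemma trap_out a b r x : 0 < r -> a + r <= b - r -> ~ `]a, b[%classic x ->
  trap a b r x = 0.
Proof.
move=> r0 ab xab; rewrite /trap.
have [xa|xa] := leP x a.
  by rewrite !step_le ?mulr0 ?addr0//; lra.
have bx : b <= x by rewrite leNgt; apply/negP => xb; apply: xab; rewrite /= in_itv/= xa.
by rewrite !step_ge ?mulr1 ?subrr//; lra.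
Qed.

Lemma trap_in a b r x : 0 < r -> a + r <= x -> x <= b - r -> trap a b r x = 1.
Proof.
by move=> r0 ax xb; rewrite /trap step_ge ?step_le ?mulr0 ?addr0//; lra.
Qed.

Lemma dtrap_bound a b r x : 0 < r -> `|dtrap a b r x| <= 2 / r.
Proof.
move=> r0; have := @dstep_bound a (a + r) x; have := @dstep_bound (b - r) b x.
rewrite (_ : b - (b - r) = r); last by lra.
rewrite (_ : a + r - a = r); last by lra.
move=> /(_ _)/andP[|a1 a2]; first lra.
move=> /(_ _)/andP[|b1 b2]; first lra.
by rewrite ler_norml /dtrap; apply/andP; split; lra.
Qed.

Lemma dtrap_flat a b r x : 0 < r -> a + r <= b - r ->
  x <= a \/ (a + r <= x /\ x <= b - r) \/ b <= x -> dtrap a b r x = 0.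
Proof.
move=> r0 ab H; rewrite /dtrap.
have [xa|xa] := pselect (`]a, a + r[%classic x); have [xb|xb] := pselect (`]b - r, b[%classic x).
- move: xa xb; rewrite /= !in_itv/= => /andP[? ?] /andP[? ?]; lra.
- move: xa xb; rewrite /= !in_itv/= => /andP[? ?] xb.
  exfalso; apply: xb; lra.
- move: xa xb; rewrite /= !in_itv/= => xa /andP[? ?].
  exfalso; apply: xa; lra.
- by rewrite !dstep_out ?mulr0 ?addr0//; lra.
Qed.

End step.

(** * Test fields and fluxes *)

Section test_fields.
Context {R : realType}.
Notation mu := (@lebesgue_measure R).
Notation mu2 := (mu \x mu)%E.
Notation L2 := (@lebesgue2 R).
Notation ct := (caratheodory_type (mu2^*)%mu).
Implicit Types (phi psi : R * R -> R * R).

Definition closed_boxn (r : R) : set (R * R) := (`[- r, r] `*` `[- r, r])%classic.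

Lemma boxnS (r r' : R) x : boxn r x -> r <= r' -> boxn r' x.
Proof. by rewrite /boxn/= !in_itv/= => -[? ?] ?; lra. Qed.

Lemma compact_closed_boxn r : compact (closed_boxn r).
Proof. by apply: compact_setX; exact: segment_compact. Qed.

Lemma closed_closed_boxn r : closed (closed_boxn r).
Proof. by apply: compact_closed; [exact: norm_hausdorff|exact: compact_closed_boxn]. Qed.

Lemma mk_test_field (u w : R * R -> R) (r : R) : C1fun u -> C1fun w ->
  (forall x, ~ boxn r x -> u x = 0 /\ w x = 0) ->
  (forall x, u x ^+ 2 + w x ^+ 2 <= 1) ->
  test_field (fun x => (u x, w x)).
Proof.
move=> Cu Cw uw0 uw1; split => /=; first exact: C1fun_pair.
  apply: (@subclosed_compact _ _ (closed_boxn r)); [exact: closed_closure|exact: compact_closed_boxn|].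
  rewrite ((closure_id _).1 (@closed_closed_boxn r)).
  apply: closure_subset => x /= /eqP uwx.
  apply: contrapT => xr; apply: uwx.
  have [|-> ->//] := uw0 x.
  by move=> [/=]; rewrite !in_itv/= => ? ?; apply: xr; rewrite /closed_boxn/= !in_itv/=; lra.
by move=> x; rewrite -sqrtr1 ler_wsqrtr.
Qed.

Lemma test_field_C1 phi : test_field phi -> C1fun (fun x => (phi x).1) /\
  C1fun (fun x => (phi x).2).
Proof. by move=> [? _ _]; split; [exact: C1fun_fst|exact: C1fun_snd]. Qed.

Lemma test_field_le1 phi x : test_field phi -> (phi x).1 ^+ 2 + (phi x).2 ^+ 2 <= 1.
Proof.
move=> [_ _ /(_ x)]; rewrite -[leRHS]sqrtr1 ler_sqrt//.
Qed.

Lemma test_field_le1l phi x : test_field phi -> `|(phi x).1| <= 1.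
Proof.
move=> /(test_field_le1 x) h; rewrite -(@ler_pXn2r _ 2)// ?nnegrE// expr1n real_normK ?num_real//.
by apply: le_trans h; rewrite lerDl sqr_ge0.
Qed.

Lemma test_field_le1r phi x : test_field phi -> `|(phi x).2| <= 1.
Proof.
move=> /(test_field_le1 x) h; rewrite -(@ler_pXn2r _ 2)// ?nnegrE// expr1n real_normK ?num_real//.
by apply: le_trans h; rewrite lerDr sqr_ge0.
Qed.

(** The field vanishes on a neighbourhood of each point outside the box and not only at that point,
    which makes its derivatives vanish there too. *)
Lemma test_field_bounded phi : test_field phi ->
  exists2 r : R, 0 < r & forall x, ~ closed_boxn r x -> \forall y \near x, phi y = 0.
Proof.
move=> [_ /compact_bounded[M [Mr hM]] _].
pose r := `|M| + 1; have r0 : 0 < r by rewrite /r; have := normr_ge0 M; lra.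
have Mlt : M < r by rewrite /r; have := ler_norm M; lra.
exists r => // x xr.
have oC : open (~` closure [set x | phi x != 0]).
  by apply: closed_openC; exact: closed_closure.
have xC : (~` closure [set x | phi x != 0]) x.
  move=> xc; apply: xr; have := hM _ Mlt _ xc.
  rewrite /= prod_normE ge_max => /andP[]; rewrite !ler_norml => h1 h2.
  by rewrite /closed_boxn/= !in_itv/=.
move: (open_nbhs_nbhs (conj oC xC)); apply: filterS => y /= yC.
apply/eqP; apply: contrapT => /negP py; apply: yC.
exact: subset_closure.
Qed.

Lemma continuous_div2 phi : test_field phi -> continuous (div2 phi).
Proof.
move=> [[dphi cphi] _ _] x; apply: cvgD.
  by apply: (@cvg_comp _ _ _ (fun x => 'D_(1, 0) phi x) fst); [exact: cphi|exact: cvg_fst].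
by apply: (@cvg_comp _ _ _ (fun x => 'D_(0, 1) phi x) snd); [exact: cphi|exact: cvg_snd].
Qed.

Lemma test_field_supp phi : test_field phi ->
  exists M r : R, [/\ 0 <= M, 0 < r, forall x, `|div2 phi x| <= M,
    forall x, ~ boxn r x -> phi x = 0 & forall x, ~ boxn r x -> div2 phi x = 0].
Proof.
move=> tphi; have [r r0 hr] := test_field_bounded tphi.
have div0 x : ~ closed_boxn r x -> div2 phi x = 0.
  move=> /hr phi0; rewrite /div2 !(@near_eq_derive _ _ _ phi (cst 0) x)//.
  by rewrite !derive_cst addr0.
have boxS x : ~ boxn (r + 1) x -> ~ closed_boxn r x.
  move=> xb [/=]; rewrite !in_itv/= => ? ?; apply: xb.
  by rewrite /boxn/= !in_itv/=; lra.
have [M Mh] : exists M, forall x, closed_boxn r x -> `|div2 phi x| <= M.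
  have : compact (div2 phi @` closed_boxn r).
    apply: continuous_compact; last exact: compact_closed_boxn.
    by apply: continuous_subspaceT; exact: continuous_div2.
  move=> /compact_bounded[M [_ hM]]; exists (M + 1) => x xr.
  by apply: (hM (M + 1)); [lra|exists x].
(* The radius grows by one so that an open box contains the closed box found above. *)
exists `|M|, (r + 1); split => //.
- by lra.
- move=> x; have [xr|xr] := pselect (closed_boxn r x).
    by rewrite (le_trans (Mh _ xr))// ler_norm.
  by rewrite div0// normr0.
- by move=> x /boxS /hr /nbhs_singleton.
- by move=> x /boxS /div0.
Qed.

Lemma measurable_div2 phi : test_field phi -> measurable_fun setT (div2 phi).
Proof. by move=> /continuous_div2; exact: continuous_measurable_plane. Qed.

Lemma integrable_div2 phi E : test_field phi -> lebesgue2_measurable E ->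
  L2.-integrable (E : set ct) (EFin \o div2 phi).
Proof.
move=> tphi mE; have [M [r [M0 r0 hM _ h0]]] := test_field_supp tphi.
have mb : measurable (boxn r : set ct) := lebesgue2_measurable_boxn r.
have mf := measurable_fun_ct (measurable_div2 tphi).
exact: (integrable_bounded_support mE mb (lebesgue2_boxn_lty r) mf (fun x _ => hM x) h0).
Qed.

(** The real-valued form of the integrals in [perimeter]; for a smooth set it is the flux of the
    field through the boundary. *)
Definition flux (E : set (R * R)) phi : R := \int[L2]_(x in E) div2 phi x.

Lemma fluxE E phi : test_field phi -> lebesgue2_measurable E ->
  (\int[L2]_(x in E) (div2 phi x)%:E)%E = (flux E phi)%:E.
Proof.
by move=> tphi mE; rewrite /flux /Rintegral fineK// integrable_fin_num//;
  exact: integrable_div2.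
Qed.

Lemma flux_eq E E' phi : test_field phi -> lebesgue2_measurable E ->
  lebesgue2_measurable E' -> L2 (E `+` E') = 0%E -> flux E phi = flux E' phi.
Proof.
move=> tphi mE mE' EE'; apply: Rintegral_lebesgue2_eq => //.
  exact: measurable_div2.
by apply: integrable_div2 => //; exact: lebesgue2_measurable_borel.
Qed.

Lemma test_field0 : test_field (fun _ : R * R => (0, 0) : R * R).
Proof.
apply: (@mk_test_field _ _ 1); [exact: C1fun_cst|exact: C1fun_cst|by []|].
by move=> x; rewrite expr0n addr0 ler01.
Qed.

Lemma div20 x : div2 (fun _ : R * R => (0, 0) : R * R) x = 0.
Proof. by rewrite /div2 !derive_cst addr0. Qed.

Lemma flux0 E : flux E (fun=> (0, 0)) = 0.
Proof.
by rewrite /flux /Rintegral integral0_eq// => x _; rewrite div20.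
Qed.

Lemma div2D phi psi x : test_field phi -> test_field psi ->
  div2 (phi \+ psi) x = div2 phi x + div2 psi x.
Proof.
move=> [[dphi _] _ _] [[dpsi _] _ _]; rewrite /div2 !deriveD//; try exact: diff_derivable.
exact: addrACA.
Qed.

(** At each point at most one of the two fields is nonzero, so the sum still has norm at most 1.
    Superadditivity of the perimeter over disjoint sets rests on this. *)
Lemma test_fieldD_disjoint phi psi (O O' : set (R * R)) : test_field phi -> test_field psi ->
  O `&` O' = set0 -> (forall x, ~ O x -> phi x = 0) -> (forall x, ~ O' x -> psi x = 0) ->
  test_field (phi \+ psi).
Proof.
move=> tphi tpsi OO' phi0 psi0.
have [M [r [_ _ _ hr _]]] := test_field_supp tphi.
have [M' [r' [_ _ _ hr' _]]] := test_field_supp tpsi.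
have [C1 C2] := test_field_C1 tphi; have [C1' C2'] := test_field_C1 tpsi.
rewrite (_ : _ \+ _ = fun x => ((phi x).1 + (psi x).1, (phi x).2 + (psi x).2)); last by [].
apply: (@mk_test_field _ _ (Num.max r r')).
- exact: C1funD.
- exact: C1funD.
- move=> x xr; rewrite hr ?hr' ?addr0//.
    by move=> /(@boxnS _ (Num.max r r')); rewrite le_max lexx orbT => /(_ isT).
  by move=> /(@boxnS _ (Num.max r r')); rewrite le_max lexx => /(_ isT).
- move=> x; have [xO|xO] := pselect (O x).
    rewrite psi0 ?addr0; first exact: test_field_le1.
    by move=> xO'; rewrite -[False]/(set0 x) -OO'.
  by rewrite phi0// !add0r; exact: test_field_le1.
Qed.

Lemma fluxD E phi psi : lebesgue2_measurable E -> test_field phi -> test_field psi ->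
  flux E (phi \+ psi) = flux E phi + flux E psi.
Proof.
move=> mE tphi tpsi; rewrite /flux -RintegralD//; try exact: integrable_div2.
by apply: eq_Rintegral => x _; rewrite div2D.
Qed.

End test_fields.

(** * Cutting a set along the boundary of a rectangle *)

Section cut.
Context {R : realType}.
Notation mu := (@lebesgue_measure R).
Notation mu2 := (mu \x mu)%E.
Notation L2 := (@lebesgue2 R).
Notation ct := (caratheodory_type (mu2^*)%mu).
Implicit Types (phi psi : R * R -> R * R).

Lemma perimeter_ge E phi : test_field phi -> lebesgue2_measurable E ->
  ((flux E phi)%:E <= @perimeter R E)%E.
Proof.
by move=> tphi mE; apply: ereal_sup_ubound; exists phi => //; exact: fluxE.
Qed.

Lemma perimeter_ge0 E : lebesgue2_measurable E -> (0 <= @perimeter R E)%E.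
Proof.
by move=> mE; have := perimeter_ge test_field0 mE; rewrite flux0.
Qed.

Lemma perimeter_le E (M : \bar R) : lebesgue2_measurable E ->
  (forall phi, test_field phi -> ((flux E phi)%:E <= M)%E) -> (perimeter E <= M)%E.
Proof.
by move=> mE h; apply: ge_ereal_sup => _ [phi tphi <-]; rewrite fluxE//; exact: h.
Qed.

(** Meant for [F] a thin frame of width [r]: there the divergences differ by a [K] of order $1/r$,
    which is harmless once the measure [e] is $o(r)$. *)
Lemma flux_close E F phi psi (K e : R) : lebesgue2_measurable E ->
  lebesgue2_measurable F -> test_field phi -> test_field psi -> 0 <= K ->
  (forall x, E x -> ~ F x -> div2 phi x = div2 psi x) ->
  (forall x, F x -> `|div2 phi x - div2 psi x| <= K) ->
  (L2 (E `&` F) <= e%:E)%E -> flux E phi <= flux E psi + K * e.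
Proof.
move=> mE mF tphi tpsi K0 eqF leK EF.
have mEF : measurable (E `&` F : set ct) by exact: measurableI.
have mf := measurable_funB (measurable_fun_ct (measurable_div2 tphi)) (measurable_fun_ct (measurable_div2 tpsi)).
have EFoo : (L2 (E `&` F) < +oo)%E by apply: le_lt_trans EF _; rewrite ltry.
have := le_normr_Rintegral_bound mEF EFoo mf (fun x h => leK x (proj2 h)).
have intf := integrable_div2 tphi mE; have intg := integrable_div2 tpsi mE.
have intfg : L2.-integrable (E : set ct) (EFin \o (div2 phi \- div2 psi)%R).
  exact: (integrableB mE intf intg).
have -> : \int[L2]_(x in E `&` F) (div2 phi \- div2 psi) x = flux E phi - flux E psi.
  have E0 : \int[L2]_(x in E `\` F) (div2 phi \- div2 psi) x = 0.
    rewrite /Rintegral integral0_eq; first by [].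
    by move=> x [Ex nFx]; rewrite /= eqF ?subrr.
  rewrite /flux -(RintegralB mE intf intg).
  by have := Rintegral_splitD mE mF intfg; rewrite E0 addr0.
move=> h; have : flux E phi - flux E psi <= K * e.
  apply: le_trans (ler_norm _) _; apply: le_trans h _; rewrite ler_wpM2l//.
  by rewrite -lee_fin fineK// ge0_fin_numE// lebesgue2_ge0.
by rewrite lerBlDl addrC.
Qed.

Definition box (a b c d : R) : set (R * R) := (`]a, b[ `*` `]c, d[)%classic.
Definition cbox (a b c d : R) : set (R * R) := (`[a, b] `*` `[c, d])%classic.

(** The layer around the boundary, on both of its sides, outside which the two cutoffs are locally 0
    or 1. *)
Definition frame (a b c d r : R) : set (R * R) :=
  box (a - r) (b + r) (c - r) (d + r) `\` cbox (a + r) (b - r) (c + r) (d - r).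

Lemma measurable_frame a b c d r : measurable (frame a b c d r).
Proof. by apply: measurableD; exact: measurableX. Qed.

Lemma widen_le (a b r : R) : 0 < r -> a + r <= b - r -> a - r + r <= b + r - r.
Proof. lra. Qed.

(** The real variables stand for the values at one point of the cutoffs, the fields and their
    derivatives, which keeps the triangle inequalities free of calculus. *)
Lemma glue_bound (e z t s M M' k d1 d2 d3 d4 p1 p2 q1 q2 : R) : 0 <= k ->
  0 <= e <= 1 -> 0 <= z <= 1 -> `|t| <= M -> `|s| <= M' ->
  `|d1| <= k -> `|d2| <= k -> `|d3| <= k -> `|d4| <= k ->
  `|p1| <= 1 -> `|p2| <= 1 -> `|q1| <= 1 -> `|q2| <= 1 ->
  `|e * t + (d1 * p1 + d2 * p2) + (z * s + (d3 * q1 + d4 * q2))| <=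
  M + (k + k) + (M' + (k + k)).
Proof.
move=> k0 /andP[e0 e1] /andP[z0 z1] tM sM' kd1 kd2 kd3 kd4 kp1 kp2 kq1 kq2.
have pk (d p : R) : `|d| <= k -> `|p| <= 1 -> `|d * p| <= k.
  by move=> dk p1'; rewrite normrM -[leRHS]mulr1 ler_pM.
have pm (u v m : R) : 0 <= u -> u <= 1 -> `|v| <= m -> `|u * v| <= m.
  by move=> u0 u1 vm; rewrite normrM -[leRHS]mul1r ler_pM// ger0_norm.
by do 2 (apply: le_trans (ler_normD _ _) _; apply: lerD); rewrite ?pm//;
  apply: le_trans (ler_normD _ _) _; apply: lerD; rewrite ?pk.
Qed.

Section cutoff.
Variables (a b c d r : R).
Hypotheses (r0 : 0 < r) (ab : a + r <= b - r) (cd : c + r <= d - r).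

Definition prodtrap (a b c d r : R) (x : R * R) := trap a b r x.1 * trap c d r x.2.

Lemma C1fun_prodtrap a' b' c' d' : C1fun (prodtrap a' b' c' d' r).
Proof.
apply: C1funM; [exact: (C1fun_comp_fst (C1line_trap _ _ _))|].
exact: (C1fun_comp_snd (C1line_trap _ _ _)).
Qed.

Lemma derive_prodtrap a' b' c' d' x v : 'D_v (prodtrap a' b' c' d' r) x =
  trap a' b' r x.1 * (v.2 * dtrap c' d' r x.2) + trap c' d' r x.2 * (v.1 * dtrap a' b' r x.1).
Proof.
rewrite deriveMC1; [|exact: (C1fun_comp_fst (C1line_trap _ _ _))|exact: (C1fun_comp_snd (C1line_trap _ _ _))].
by rewrite (derive_comp_fst _ _ (C1line_trap _ _ _)) (derive_comp_snd _ _ (C1line_trap _ _ _)).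
Qed.

(** [eta] lives inside the rectangle. [zeta] lives outside: it is 1 minus the product for the
    rectangle enlarged by [r], whose plateau is exactly the original rectangle. As they are never
    nonzero together, a field glued from two test fields keeps norm at most 1. *)
Definition eta x := prodtrap a b c d r x.
Definition zeta x := 1 + - 1 * prodtrap (a - r) (b + r) (c - r) (d + r) r x.

Lemma C1fun_zeta : C1fun zeta.
Proof.
apply: C1funD; first exact: C1fun_cst.
by apply: C1funM; [exact: C1fun_cst|exact: C1fun_prodtrap].
Qed.

Lemma derive_zeta x v : 'D_v zeta x = - 'D_v (prodtrap (a - r) (b + r) (c - r) (d + r) r) x.
Proof.
have CP := C1fun_prodtrap (a - r) (b + r) (c - r) (d + r).
rewrite deriveDC1; [|exact: C1fun_cst|by apply: C1funM => //; exact: C1fun_cst].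
rewrite deriveMC1//; last exact: C1fun_cst.
by rewrite !derive_cst mulr0 addr0 add0r mulN1r.
Qed.

Lemma eta01 x : 0 <= eta x <= 1.
Proof.
have /andP[h1 h2] := trap01 x.1 r0 ab; have /andP[h3 h4] := trap01 x.2 r0 cd.
by rewrite /eta /prodtrap mulr_ge0//= mulr_ile1.
Qed.

Lemma zeta01 x : 0 <= zeta x <= 1.
Proof.
have ra := widen_le r0 ab; have rc := widen_le r0 cd.
have h1 := trap01 x.1 r0 ra; have h2 := trap01 x.2 r0 rc.
by rewrite /zeta /prodtrap; apply/andP; split; nra.
Qed.

Lemma eta_zeta x : eta x = 0 \/ zeta x = 0.
Proof.
have r0' := r0; have ab_ := ab; have cd_ := cd.
have [xQ|xQ] := pselect (box a b c d x); [right|left].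
  move: xQ; rewrite /zeta /prodtrap /box/= !in_itv/= => -[? ?].
  by rewrite !trap_in// ?mulr1 ?subrr//; lra.
rewrite /eta /prodtrap; have [x1|x1] := pselect (`]a, b[%classic x.1); last by rewrite trap_out ?mul0r.
by rewrite (@trap_out _ c d) ?mulr0// => x2; exact: xQ.
Qed.

Lemma cutoff_in x : cbox (a + r) (b - r) (c + r) (d - r) x ->
  [/\ eta x = 1, zeta x = 0, forall v, 'D_v eta x = 0 & forall v, 'D_v zeta x = 0].
Proof.
have r0' := r0; have ab_ := ab; have cd_ := cd.
rewrite /cbox/= !in_itv/= => -[? ?]; split.
- by rewrite /eta /prodtrap !trap_in ?mulr1//; lra.
- by rewrite /zeta /prodtrap !trap_in ?mulr1 ?subrr//; lra.
- move=> v; rewrite derive_prodtrap (@dtrap_flat _ a b) ?(@dtrap_flat _ c d) ?mulr0 ?addr0//;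
    by right; left; split; lra.
- move=> v; rewrite derive_zeta derive_prodtrap (@dtrap_flat _ (a - r) (b + r)) ?(@dtrap_flat _ (c - r) (d + r)) ?mulr0 ?addr0 ?oppr0//;
    (try lra); by right; left; split; lra.
Qed.

Lemma prodtrap_out a' b' c' d' x : a' + r <= b' - r -> c' + r <= d' - r ->
  ~ box a' b' c' d' x ->
  prodtrap a' b' c' d' r x = 0 /\ forall v, 'D_v (prodtrap a' b' c' d' r) x = 0.
Proof.
have r0' := r0; have ab_ := ab; have cd_ := cd.
move=> ab' cd' xQ; have [x1|x1] := pselect (`]a', b'[%classic x.1).
  have x2 : ~ `]c', d'[%classic x.2 by move=> x2; exact: xQ.
  have t0 : trap c' d' r x.2 = 0 by exact: trap_out.
  split; first by rewrite /prodtrap t0 mulr0.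
  move=> v; rewrite derive_prodtrap t0 (@dtrap_flat _ c' d') ?mulr0 ?mul0r ?addr0//.
  have [?|?] := leP x.2 c'; first by left.
  by right; right; rewrite leNgt; apply/negP => ?; apply: x2; rewrite /= in_itv/=; lra.
have t0 : trap a' b' r x.1 = 0 by exact: trap_out.
split; first by rewrite /prodtrap t0 mul0r.
move=> v; rewrite derive_prodtrap t0 (@dtrap_flat _ a' b') ?mulr0 ?mul0r ?addr0//.
have [?|?] := leP x.1 a'; first by left.
by right; right; rewrite leNgt; apply/negP => ?; apply: x1; rewrite /= in_itv/=; lra.
Qed.

Lemma cutoff_out x : ~ box (a - r) (b + r) (c - r) (d + r) x ->
  [/\ eta x = 0, zeta x = 1, forall v, 'D_v eta x = 0 & forall v, 'D_v zeta x = 0].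
Proof.
have r0' := r0; have ab_ := ab; have cd_ := cd.
have ra := widen_le r0 ab; have rc := widen_le r0 cd.
move=> xQ; have [z0 dz0] := prodtrap_out ra rc xQ.
have xQ' : ~ box a b c d x.
  by move=> xQ'; apply: xQ; move: xQ'; rewrite /box/= !in_itv/= => -[? ?]; split; lra.
have [e0 de0] := prodtrap_out ab cd xQ'; split => //.
- by rewrite /zeta z0 mulr0 addr0.
- by move=> v; rewrite derive_zeta dz0 oppr0.
Qed.

Lemma derive_prodtrap_bound a' b' c' d' x : a' + r <= b' - r -> c' + r <= d' - r ->
  `|'D_(1, 0) (prodtrap a' b' c' d' r) x| <= 2 / r /\
  `|'D_(0, 1) (prodtrap a' b' c' d' r) x| <= 2 / r.
Proof.
move=> ab' cd'; rewrite !derive_prodtrap/= !(mul0r, mulr0, mul1r, addr0, add0r) !normrM.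
have r2 : 0 <= 2 / r by rewrite divr_ge0// ltW.
have /andP[h1 h2] := trap01 x.1 r0 ab'; have /andP[h3 h4] := trap01 x.2 r0 cd'.
split; rewrite -[leRHS]mul1r ler_pM//.
- by rewrite ger0_norm.
- exact: dtrap_bound.
- by rewrite ger0_norm.
- exact: dtrap_bound.
Qed.

Variables (phi psi : R * R -> R * R).
Hypotheses (tphi : test_field phi) (tpsi : test_field psi).

Definition glue x := (eta x * (phi x).1 + zeta x * (psi x).1,
                      eta x * (phi x).2 + zeta x * (psi x).2).

Lemma test_field_glue : test_field glue.
Proof.
have [C1 C2] := test_field_C1 tphi; have [C1' C2'] := test_field_C1 tpsi.
have [M [s [_ _ _ hs _]]] := test_field_supp tphi.
have [M' [s' [_ _ _ hs' _]]] := test_field_supp tpsi.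
apply: (@mk_test_field _ _ _ (Num.max s s')).
- exact: (C1funD (C1funM (C1fun_prodtrap _ _ _ _) C1) (C1funM C1fun_zeta C1')).
- exact: (C1funD (C1funM (C1fun_prodtrap _ _ _ _) C2) (C1funM C1fun_zeta C2')).
- move=> x xr; rewrite hs ?hs' ?mulr0 ?addr0//.
    by move=> /(@boxnS _ _ (Num.max s s')); rewrite le_max lexx orbT => /(_ isT).
  by move=> /(@boxnS _ _ (Num.max s s')); rewrite le_max lexx => /(_ isT).
- move=> x; have h1 := test_field_le1 x tphi; have h2 := test_field_le1 x tpsi.
  have /andP[e0 e1] := eta01 x; have /andP[z0 z1] := zeta01 x.
  move: (eta x) (zeta x) e0 e1 z0 z1 (eta_zeta x) => e z e0 e1 z0 z1.
  move=> [->|->]; rewrite !mul0r !(add0r, addr0) !exprMn -mulrDr.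
    by rewrite mulr_ile1// ?exprn_ile1// ?addr_ge0 ?sqr_ge0.
  by rewrite mulr_ile1// ?exprn_ile1// ?addr_ge0 ?sqr_ge0.
Qed.

Lemma div2_glue x : div2 glue x =
  eta x * div2 phi x + ('D_(1, 0) eta x * (phi x).1 + 'D_(0, 1) eta x * (phi x).2) +
  (zeta x * div2 psi x + ('D_(1, 0) zeta x * (psi x).1 + 'D_(0, 1) zeta x * (psi x).2)).
Proof.
have [C1 C2] := test_field_C1 tphi; have [C1' C2'] := test_field_C1 tpsi.
have Ce : C1fun eta := C1fun_prodtrap _ _ _ _; have Cz := C1fun_zeta.
have [[dg _] _ _] := test_field_glue; have [[dphi _] _ _] := tphi; have [[dpsi _] _ _] := tpsi.
rewrite !div2E// /glue/=.
have Ce1 := C1funM Ce C1; have Ce2 := C1funM Ce C2.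
have Cz1 := C1funM Cz C1'; have Cz2 := C1funM Cz C2'.
rewrite (deriveDC1 _ _ Ce1 Cz1) (deriveDC1 _ _ Ce2 Cz2).
rewrite (deriveMC1 _ _ Ce C1) (deriveMC1 _ _ Ce C2) (deriveMC1 _ _ Cz C1') (deriveMC1 _ _ Cz C2').
have idt (e z p1 p2 q1 q2 t1 t2 t3 t4 t5 t6 t7 t8 : R) :
  (e * t1 + p1 * t2 + (z * t3 + q1 * t4)) + (e * t5 + p2 * t6 + (z * t7 + q2 * t8)) =
  e * (t1 + t5) + (t2 * p1 + t6 * p2) + (z * (t3 + t7) + (t4 * q1 + t8 * q2)) by ring.
exact: idt.
Qed.

Lemma div2_glue_bound M M' x : (forall x, `|div2 phi x| <= M) ->
  (forall x, `|div2 psi x| <= M') -> `|div2 glue x| <= M + M' + 8 / r.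
Proof.
have r0' := r0; have ab_ := ab; have cd_ := cd.
have ra := widen_le r0 ab; have rc := widen_le r0 cd.
move=> hM hM'; rewrite div2_glue.
(* Two cutoffs with two partial derivatives each, all bounded by $2/r$, account for $8/r$. *)
have -> : M + M' + 8 / r = M + (2 / r + 2 / r) + (M' + (2 / r + 2 / r)) by field; lra.
have r2 : 0 <= 2 / r by rewrite divr_ge0// ltW.
have [d1 d2] := derive_prodtrap_bound x ab cd; have [d3 d4] := derive_prodtrap_bound x ra rc.
have d3' : `|'D_(1, 0) zeta x| <= 2 / r by rewrite derive_zeta normrN.
have d4' : `|'D_(0, 1) zeta x| <= 2 / r by rewrite derive_zeta normrN.
exact: (glue_bound r2 (eta01 x) (zeta01 x) (hM x) (hM' x) d1 d2 d3' d4'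
  (test_field_le1l x tphi) (test_field_le1r x tphi)
  (test_field_le1l x tpsi) (test_field_le1r x tpsi)).
Qed.

End cutoff.

(** One inequality is the additivity of the integral. For the other, a field for the inner piece and
    one for the outer piece are glued into a single field: the error is the gradient of the cutoffs,
    of order $1/r$ and confined to the frame, times the measure of [A] in the frame, which is at
    most [e * r]. *)
Lemma perimeter_cut (A : set (R * R)) (a b c d : R) : lebesgue2_measurable A ->
  (perimeter A < +oo)%E ->
  (forall e, 0 < e -> exists r, [/\ 0 < r < e, a + r <= b - r, c + r <= d - r &
     (L2 (A `&` frame a b c d r) <= (e * r)%:E)%E]) ->
  perimeter A = (perimeter (A `&` box a b c d) + perimeter (A `\` box a b c d))%E.
Proof.
move=> mA Aoo thin; set Q := box a b c d.
have mQ : lebesgue2_measurable Q by apply: lebesgue2_measurable_borel; exact: measurableX.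
have mAQ : lebesgue2_measurable (A `&` Q) by exact: (@measurableI _ ct).
have mAnQ : lebesgue2_measurable (A `\` Q) by exact: (@measurableD _ ct).
apply/eqP; rewrite eq_le; apply/andP; split.
  apply: perimeter_le => // phi tphi.
  rewrite /flux (Rintegral_splitD mA mQ (integrable_div2 tphi mA)) EFinD.
  by apply: leeD; exact: perimeter_ge.
have Afin : perimeter A \is a fin_num by rewrite ge0_fin_numE// perimeter_ge0.
have key phi psi : test_field phi -> test_field psi ->
    flux (A `&` Q) phi + flux (A `\` Q) psi <= fine (perimeter A).
  move=> tphi tpsi.
  have [M [_ [M0 _ hM _ _]]] := test_field_supp tphi.
  have [M' [_ [M0' _ hM' _ _]]] := test_field_supp tpsi.
  apply/ler_addgt0Pr => e e0.
  (* The total error is $2 K e' r = e' (4 (M + M') r + 16)$, hence at most $e' C$ once $r < 1$; the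
     minimum with 1 below enforces this. *)
  pose C := 4 * (M + M') + 16; have C0 : 0 < C by rewrite /C; lra.
  have [|r [/andP[r0 re] ab cd Ar]] := thin (Num.min 1 (e / C)).
    by rewrite lt_min ltr01 divr_gt0.
  move: re; rewrite lt_min => /andP[r1 _].
  pose e' := Num.min 1 (e / C); have e'C : e' * C <= e.
    by rewrite -ler_pdivlMr// /e' ge_min lexx orbT.
  have e'0 : 0 < e' by rewrite /e' lt_min ltr01 divr_gt0.
  have tg := test_field_glue r0 ab cd tphi tpsi.
  have mF : lebesgue2_measurable (frame a b c d r).
    by apply: lebesgue2_measurable_borel; exact: measurable_frame.
  pose K := 2 * (M + M') + 8 / r.
  have r8 : 0 <= 8 / r by rewrite divr_ge0// ltW.
  have K0 : 0 <= K by rewrite /K; lra.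
  have hg x := div2_glue_bound r0 ab cd tphi tpsi x hM hM'.
  have h1 : flux (A `&` Q) phi <= flux (A `&` Q) (glue a b c d r phi psi) + K * (e' * r).
    apply: (flux_close mAQ mF tphi tg K0).
    - move=> x [Ax Qx] nFx; have xin : cbox (a + r) (b - r) (c + r) (d - r) x.
        apply: contrapT => xin; apply: nFx; split => //.
        by move: Qx r0; rewrite /Q /box/= !in_itv/=; clear; move=> [? ?] ?; split; lra.
      have [E1 E2 E3 E4] := cutoff_in r0 ab cd xin.
      by rewrite (div2_glue r0 ab cd)// E1 E2 !E3 !E4 !(mul0r, mul1r, addr0).
    - move=> x _; apply: le_trans (ler_normB _ _) _.
      by apply: le_trans (lerD (hM x) (hg x)) _; move: M0 M0'; rewrite /K; clear; lra.
    - by apply: le_trans Ar; apply: le_lebesgue2 => x [[Ax _] Fx].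
  have h2 : flux (A `\` Q) psi <= flux (A `\` Q) (glue a b c d r phi psi) + K * (e' * r).
    apply: (flux_close mAnQ mF tpsi tg K0).
    - move=> x [Ax Qx] nFx; have xin : ~ box (a - r) (b + r) (c - r) (d + r) x.
        move=> xin; apply: nFx; split => // xc; apply: Qx.
        by move: xc r0; rewrite /Q /cbox /box/= !in_itv/=; clear; move=> [? ?] ?; split; lra.
      have [E1 E2 E3 E4] := cutoff_out r0 ab cd xin.
      by rewrite (div2_glue r0 ab cd)// E1 E2 !E3 !E4 !(mul0r, mul1r, addr0, add0r).
    - move=> x _; apply: le_trans (ler_normB _ _) _.
      by apply: le_trans (lerD (hM' x) (hg x)) _; move: M0 M0'; rewrite /K; clear; lra.
    - by apply: le_trans Ar; apply: le_lebesgue2 => x [[Ax _] Fx].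
  have h3 : flux (A `&` Q) (glue a b c d r phi psi) + flux (A `\` Q) (glue a b c d r phi psi)
     <= fine (perimeter A).
    rewrite -(Rintegral_splitD mA mQ (integrable_div2 tg mA)) -lee_fin (fineK Afin).
    exact: (perimeter_ge tg mA).
  have h4 : 2 * (K * (e' * r)) <= e.
    apply: le_trans e'C.
    have -> : 2 * (K * (e' * r)) = e' * (4 * (M + M') * r + 16).
      by move: (r0); rewrite /K; clear; move=> ?; field; lra.
    by rewrite ler_wpM2l ?(ltW e'0)//; move: M0 M0' r0 r1; rewrite /C; clear; nra.
  have arith (f1 f2 g1 g2 k m : R) : f1 <= g1 + k -> f2 <= g2 + k -> g1 + g2 <= m ->
    2 * k <= e -> f1 + f2 <= m + e by clear; lra.
  exact: arith h1 h2 h3 h4.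
(* The two suprema are taken one after the other. The zero field outside shows first that the
   perimeter of the inner piece is finite, so that it may be subtracted. *)
have key2 phi : test_field phi -> (perimeter (A `&` Q) <= (fine (perimeter A) - flux (A `\` Q) phi)%:E)%E.
  move=> tphi; apply: perimeter_le => // psi tpsi.
  by rewrite lee_fin lerBrDr; exact: key.
have AQfin : perimeter (A `&` Q) \is a fin_num.
  rewrite ge0_fin_numE; last exact: (perimeter_ge0 mAQ).
  by apply: le_lt_trans (key2 _ test_field0) _; rewrite ltry.
rewrite -(fineK AQfin) -(fineK Afin) -leeBrDl// -EFinB; apply: perimeter_le => // psi tpsi.
have swap (x y z : R) : x <= y - z -> z <= y - x by clear; lra.
by move: (key2 psi tpsi); rewrite -{1}(fineK AQfin) !lee_fin; exact: swap.
Qed.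

End cut.

(** * Slicing *)

Section dense.
Context {R : realType}.
Notation mu := (@lebesgue_measure R).
Notation rT := (measurableTypeR R).

Lemma itv_measure_lty (x y : R) : (mu `]x, y[%classic < +oo)%E.
Proof. by rewrite lebesgue_measure_itv/=; case: ifP => _; rewrite -?EFinB ltry. Qed.

(** A density point of [A] supplies the interval. Its endpoints are rational so that, over all
    slices, only countably many averages ever occur. *)
Lemma dense_interval (A : set R) (a b : R) : measurable A ->
  (0 < mu (A `&` `]a, b[))%E ->
  exists p q : rat, [/\ a <= ratr p, (ratr p : R) < ratr q, ratr q <= b &
    (mu (`]ratr p, ratr q[ `\` A) <= ((ratr q - ratr p) / 10)%:E)%E].
Proof.
move=> mA Apos.
have [Z [mZ Z0 hZ]] := lebesgue_density mA.
have [x [[Ax xab] xZ]] : exists x, (A `&` `]a, b[) x /\ ~ Z x.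
  apply: contrapT => nex; move: Apos; apply/negP; rewrite -leNgt -Z0.
  apply: le_measure; rewrite ?inE//; first exact: measurableI.
  by move=> x Axab; apply: contrapT => nZ; apply: nex; exists x.
have dens : (mu (A `&` ball x r) * (mu (ball x r))^-1)%E @[r --> 0^'+] --> (\1_A x)%:E.
  by apply: contrapT => nd; apply: xZ; apply: hZ.
(* A density above $1 - 1/40$ leaves at most $2r/40$ of the ball outside [A], while the rational
   interval chosen below is longer than $r$. *)
move: dens; rewrite indicE mem_set//= => /fine_cvgP[_] /cvgrPdist_lt.
move=> /(_ (40%:R^-1)) /(_ _)[//|e/= e0 he].
move: xab; rewrite /= in_itv/= => /andP[ax xb].
pose r := Num.min (e / 2) (Num.min (x - a) (b - x)).
have r0 : 0 < r by rewrite /r !lt_min divr_gt0//=; lra.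
have [re [rxa rbx]] : r < e /\ r <= x - a /\ r <= b - x.
  rewrite /r !ge_min !lexx !orbT gt_min; split => //; apply/orP; left; lra.
have := he r; rewrite /ball/= sub0r normrN gtr0_norm// => /(_ re r0).
have mball : measurable (ball x r : set R) by exact: measurable_ball.
have ballE : mu (ball x r) = (r *+ 2)%:E by rewrite lebesgue_measure_ball// ltW.
have rne : r *+ 2 != 0 by rewrite mulrn_eq0/= gt_eqF.
have Abfin : mu (A `&` ball x r) \is a fin_num.
  rewrite ge0_fin_numE//; apply: (@le_lt_trans _ _ (mu (ball x r))).
    by apply: le_measure; rewrite ?inE//; exact: measurableI.
  by rewrite ballE ltry.
rewrite ballE inver (negbTE rne) fineM//= => h.
have bA : (mu (ball x r `\` A) <= (r / 20)%:E)%E.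
  rewrite measureD//=; last by rewrite ballE ltry.
  rewrite setIC ballE -(fineK Abfin) -EFinB lee_fin.
  move: h; set m := fine _ => h.
  have mk : m = (m * (r *+ 2)^-1) * (r *+ 2) by rewrite mulfVK.
  have kn := ler_norm (1 - m * (r *+ 2)^-1).
  rewrite {}mk; move: (m * _) h kn => k h kn; rewrite !mulr2n.
  have : (1 - k) * r <= 40^-1 * r by rewrite ler_wpM2r ?(ltW r0)//; lra.
  by lra.
have [|p] := @rat_in_itvoo R (x - r) (x - r / 2); first by lra.
have [|q] := @rat_in_itvoo R (x + r / 2) (x + r); first by lra.
rewrite !in_itv/= => /andP[q1 q2] /andP[p1 p2].
exists p, q; split; [lra..|].
apply: (@le_trans _ _ (mu (ball x r `\` A))).
  apply: le_measure; rewrite ?inE//; [exact: measurableD|exact: measurableD|].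
  apply: setSD => y; rewrite /= in_itv/= => /andP[y1 y2].
  by rewrite /ball/= ltr_norml; lra.
by apply: le_trans bA _; rewrite lee_fin; lra.
Qed.

Lemma integrable_dstep (A : set R) (p q : R) : p < q -> measurable A ->
  mu.-integrable A (EFin \o dstep p q).
Proof.
move=> pq mA; apply: (@integrable_bounded_support _ rT R mu A `]p, q[%classic _ (2 / (q - p))).
- exact: mA.
- exact: measurable_itv.
- exact: itv_measure_lty.
- exact: measurable_dstep.
- by move=> x _; have /andP[d0 d2] := dstep_bound x pq; rewrite ger0_norm.
- by move=> x xpq; rewrite dstep_out.
Qed.

Lemma Rintegral_dstepT (p q : R) : p < q -> \int[mu]_(x in setT) dstep p q x = 1.
Proof.
move=> pq; have mI : measurable (`[p, q]%classic : set rT) by exact: measurable_itv.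
rewrite (@Rintegral_splitD _ rT R mu setT `[p, q]%classic)//; last exact: integrable_dstep.
rewrite setTI Rintegral_dstep// [X in _ + X](_ : _ = 0) ?addr0//.
rewrite /Rintegral integral0_eq// => x [_ xpq].
rewrite dstep_out// => xpq'; apply: xpq; move: xpq'; rewrite /= !in_itv/=.
by move=> /andP[/ltW -> /ltW ->].
Qed.

Lemma Rintegral_dstep_le (A : set R) (p q m : R) : p < q -> measurable A ->
  (mu (`]p, q[ `&` A) <= (m * (q - p))%:E)%E ->
  \int[mu]_(x in A) dstep p q x <= 2 * m.
Proof.
move=> pq mA mAI; have mI : measurable (`]p, q[%classic : set rT) by exact: measurable_itv.
have mIA : measurable (`]p, q[ `&` A : set rT) by exact: measurableI.
rewrite (@Rintegral_splitD _ rT R mu A `]p, q[%classic)//; last exact: integrable_dstep.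
rewrite [X in _ + X](_ : _ = 0); last first.
  by rewrite /Rintegral integral0_eq// => x [_ xpq]; rewrite dstep_out.
rewrite addr0 setIC; apply: le_trans (ler_norm _) _.
have foo : (mu (`]p, q[ `&` A) < +oo)%E by apply: le_lt_trans mAI _; rewrite ltry.
apply: le_trans (le_normr_Rintegral_bound mIA foo (@measurable_dstep _ p q) (M := 2 / (q - p)) _) _.
  by move=> x _; have /andP[d0 d2] := dstep_bound x pq; rewrite ger0_norm.
have -> : 2 * m = 2 / (q - p) * (m * (q - p)) by field; lra.
rewrite ler_wpM2l ?divr_ge0//; first lra.
by rewrite -lee_fin fineK// ge0_fin_numE.
Qed.

Lemma Rintegral_dstep_ge0 (A : set R) (p q : R) : p < q ->
  0 <= \int[mu]_(x in A) dstep p q x.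
Proof.
move=> pq; apply: Rintegral_ge0 => x _; by have /andP[] := dstep_bound x pq.
Qed.

Lemma Rintegral_dstepC (A : set R) (p q : R) : p < q -> measurable A ->
  \int[mu]_(x in A) dstep p q x = 1 - \int[mu]_(x in ~` A) dstep p q x.
Proof.
move=> pq mA; rewrite -(Rintegral_dstepT pq).
rewrite (@Rintegral_splitD _ rT R mu setT A)//; last exact: integrable_dstep.
by rewrite setTI setTD addrK.
Qed.

(** A difference of smoothed averages of the indicator of [T] over two intervals, playing the part
    of a difference quotient. It is also the integral over [T] of the derivative of a bounded
    profile, so it can be read off the flux of a test field. *)
Definition wslice (T : set R) (p q p' q' : R) :=
  \int[mu]_(x in T) dstep p q x - \int[mu]_(x in T) dstep p' q' x.

Lemma wslice_norm1 T p q p' q' : measurable T -> p < q -> p' < q' ->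
  `|wslice T p q p' q'| <= 1.
Proof.
move=> mT pq pq'; rewrite /wslice.
have h0 := Rintegral_dstep_ge0 T pq; have h0' := Rintegral_dstep_ge0 T pq'.
have := Rintegral_dstepC pq mT; have := Rintegral_dstepC pq' mT.
have := Rintegral_dstep_ge0 (~` T) pq; have := Rintegral_dstep_ge0 (~` T) pq'.
move: h0 h0'; move: (\int[mu]_(x in _) _) (\int[mu]_(x in _) _) (\int[mu]_(x in _) _) (\int[mu]_(x in _) _).
by move=> s1 s2 s3 s4 *; rewrite ler_norml; lra.
Qed.

Lemma impure_slice (T : set R) (a b : R) : measurable T ->
  (0 < mu (T `&` `]a, b[))%E -> (0 < mu (~` T `&` `]a, b[))%E ->
  exists p q p' q' : rat,
  [/\ a <= ratr p, (ratr p : R) < ratr q, ratr q <= b, (a <= ratr p') &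
   [/\ (ratr p' : R) < ratr q', ratr q' <= b &
   6 / 10 <= wslice T (ratr p) (ratr q) (ratr p') (ratr q') ]].
Proof.
move=> mT T0 CT0; have mCT : measurable (~` T) by exact: measurableC.
have [p [q [ap pq qb h]]] := dense_interval mT T0.
have [p' [q' [ap' pq' qb' h']]] := dense_interval mCT CT0.
exists p, q, p', q'; do 2!split => //.
(* A tenth of an interval weighs at most 2 / 10 under [dstep]: the first average is at least 8 / 10
   and the second at most 2 / 10. *)
rewrite /wslice (Rintegral_dstepC pq mT).
rewrite setDE setCK mulrC in h'; rewrite setDE mulrC in h.
have k1 := Rintegral_dstep_le pq' mT h'; have k2 := Rintegral_dstep_le pq mCT h.
lra.
Qed.

End dense.

(** * Lebesgue points and the covering bound for impure slices *)

Section slicing.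
Context {R : realType}.
Notation mu := (@lebesgue_measure R).
Notation rT := (measurableTypeR R).

Lemma bounded_locally_integrable (f : R -> R) (M : R) : measurable_fun setT f ->
  (forall x, `|f x| <= M) -> locally_integrable setT f.
Proof.
move=> mf fM; split => //; first exact: openT.
move=> K _ cK; have mK : measurable K by exact: compact_measurable.
have Koo := compact_finite_measure cK.
have : mu.-integrable K (EFin \o f).
  apply: measurable_bounded_integrable => //; first exact: measurable_funTS.
  exists M; split; first exact: num_real.
  by move=> y My x _; apply: le_trans (fM x) _; exact: ltW.
by move=> /integrableP[].
Qed.

Lemma mem_ball (x r t : R) : ball x r t <-> x - r < t < x + r.
Proof. by rewrite /ball/= ltr_distlC. Qed.

Lemma lebesgue_pt_avg (w : R -> R) (K y e : R) : measurable_fun setT w ->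
  (forall t, `|w t| <= K) -> lebesgue_pt w y -> 0 < e ->
  \forall r \near 0^'+, \int[mu]_(t in ball y r) `|w t - w y| <= e * r.
Proof.
move=> mw wK; rewrite /lebesgue_pt => /fine_cvgP[dfin /cvgrPdist_lt dlt] e0.
(* Half of [e], because the ball has length [2 r]. *)
have e20 : 0 < e / 2 by lra.
near=> r; have r0 : 0 < r by [].
have h1 : `|0 - fine (davg w y r)| < e / 2 by near: r; exact: dlt.
have mb : measurable (ball y r : set rT) by exact: measurable_ball.
have bE : mu (ball y r) = (r *+ 2)%:E by rewrite lebesgue_measure_ball// ltW.
have boo : (mu (ball y r) < +oo)%E by rewrite bE ltry.
have intw : mu.-integrable (ball y r) (EFin \o (fun t => w t - w y)).
  apply: (@measurable_bounded_integrable _ rT R mu _ _ mb boo).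
    by apply: measurable_funB => //; exact: measurable_funTS.
  exists (K + K); split; first exact: num_real.
  move=> m m2 t _; apply: le_trans (ler_normB _ _) _.
  exact: (le_trans (lerD (wK t) (wK y)) (ltW m2)).
have rne : r *+ 2 != 0 by rewrite mulrn_eq0/= gt_eqF.
move: h1; rewrite /davg /iavg bE inver (negbTE rne) sub0r normrN.
have -> : (\int[mu]_(t in ball y r) `|((center (w y) \o w) t)%:E|)%E =
   (\int[mu]_(t in ball y r) `|w t - w y|)%:E.
  rewrite /Rintegral fineK//; apply: integrable_fin_num => //.
  exact: integrable_norm.
rewrite -EFinM/= normrM ger0_norm; last by rewrite invr_ge0 mulrn_wge0// ltW.
rewrite ger0_norm; last by apply: Rintegral_ge0.
rewrite mulrC ltr_pdivrMr; last by rewrite mulrn_wgt0.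
move=> /ltW h; apply: le_trans h _.
by rewrite (_ : e / 2 * (r *+ 2) = e * r)// -mulr_natr; field.
Unshelve. all: by end_near. Qed.

Lemma measurable_trap a b r : measurable_fun setT (@trap R a b r).
Proof. by apply: continuous_measurable_fun; exact: (C1line_continuous (C1line_trap a b r)). Qed.

(** The trapezoid has ramps of width [r / 2], hence a plateau of length [r], where the value at [y]
    contributes at least 6 / 10 [r]; the oscillation around the Lebesgue point takes away at most 2
    / 10 [r]. *)
Lemma trap_integral_ge (w : R -> R) (y r : R) : measurable_fun setT w ->
  (forall t, `|w t| <= 1) -> 0 < r -> 6 / 10 <= w y ->
  \int[mu]_(t in ball y r) `|w t - w y| <= 2 / 10 * r ->
  4 / 10 * r <= \int[mu]_(t in setT) (trap (y - r) (y + r) (r / 2) t * w t).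
Proof.
move=> mw w1 r0 wy avg.
have r20 : 0 < r / 2 by lra.
have rr : y - r + r / 2 <= y + r - r / 2 by lra.
have mb : measurable (ball y r : set rT) by exact: measurable_ball.
have bE : mu (ball y r) = (r *+ 2)%:E by rewrite lebesgue_measure_ball// ltW.
have boo : (mu (ball y r) < +oo)%E by rewrite bE ltry.
pose T := trap (y - r) (y + r) (r / 2).
have mT : measurable_fun setT T by exact: measurable_trap.
have T0 t : 0 <= T t by have /andP[] := trap01 t r20 rr.
have T1 t : T t <= 1 by have /andP[] := trap01 t r20 rr.
have Tout t : ~ ball y r t -> T t = 0.
  by move=> yt; apply: trap_out => //; rewrite /= in_itv/= => ?; apply: yt; apply/mem_ball.
have intT : forall A : set rT, measurable A -> mu.-integrable A (EFin \o T).
  move=> A mA; apply: (integrable_bounded_support mA mb boo mT (M := 1)) => // t _.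
  by rewrite ger0_norm.
have mTw : measurable_fun setT (fun t => T t * w t) by exact: measurable_funM.
have intTw : forall A : set rT, measurable A -> mu.-integrable A (EFin \o (fun t => T t * w t)).
  move=> A mA; apply: (integrable_bounded_support mA mb boo mTw (M := 1)) => [t _|t /Tout ->].
    by rewrite normrM mulr_ile1// ger0_norm.
  by rewrite mul0r.
have intw : mu.-integrable (ball y r) (EFin \o (fun t => w t - w y)).
  apply: (@measurable_bounded_integrable _ rT R mu _ _ mb boo).
    by apply: measurable_funB => //; exact: measurable_funTS.
  exists 2; split; first exact: num_real.
  move=> m m2 t _; apply: le_trans (ler_normB _ _) _.
  by have := w1 t; have := w1 y; lra.
have intn : mu.-integrable (ball y r) (EFin \o (fun t => `|w t - w y|)) by exact: integrable_norm.
have intc : mu.-integrable (ball y r) (EFin \o (fun t => 6 / 10 * T t)).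
  by have := integrableZl mb (6 / 10) (intT _ mb).
rewrite -/T (@Rintegral_splitD _ rT R mu setT _ _ measurableT mb (intTw _ measurableT)).
rewrite setTI [X in _ + X](_ : _ = 0); last first.
  by rewrite /Rintegral integral0_eq// => t [_ /Tout ->]; rewrite mul0r.
rewrite addr0.
have h1 : \int[mu]_(t in ball y r) (6 / 10 * T t - `|w t - w y|) <=
    \int[mu]_(t in ball y r) (T t * w t).
  apply: le_Rintegral => //.
  - exact: (integrableB mb intc intn).
  - exact: intTw.
  - have aux (n u v v0 : R) : 0 <= u -> u <= 1 -> 0 <= n -> v0 - v <= n ->
      6 / 10 <= v0 -> 6 / 10 * u - n <= u * v by clear; nra.
    move=> t _; apply: (aux _ _ _ (w y)) => //.
    by rewrite distrC; exact: ler_norm.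
apply: le_trans h1; rewrite (RintegralB mb intc intn) (RintegralZl _ mb (intT _ mb)).
suff h2 : r <= \int[mu]_(t in ball y r) T t by move: h2 avg; lra.
have mI : measurable (`[y - r / 2, y + r / 2]%classic : set rT) by exact: measurable_itv.
have mbI := measurableI _ _ mb mI.
rewrite (Rintegral_splitD mb mI (intT _ mb)).
have h3 : 0 <= \int[mu]_(t in ball y r `\` `[y - r / 2, y + r / 2]) T t.
  by apply: Rintegral_ge0.
suff h4 : \int[mu]_(t in ball y r `&` `[y - r / 2, y + r / 2]) T t = r by lra.
have -> : ball y r `&` `[y - r / 2, y + r / 2]%classic = `[y - r / 2, y + r / 2]%classic.
  apply/seteqP; split => [t []//|t tI]; split => //; apply/(mem_ball y r t).
  by move: tI; rewrite /= in_itv/= => /andP[? ?]; lra.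
rewrite (@eq_Rintegral _ _ _ mu _ (cst 1)); last first.
  by move=> t; rewrite inE/= in_itv/= => /andP[? ?]; rewrite /T trap_in//; lra.
rewrite Rintegral_cst// mul1r.
suff muE : mu `[y - r / 2, y + r / 2]%classic = r%:E by exact: (congr1 fine muE).
rewrite lebesgue_measure_itv/= lte_fin ifT; last lra.
by rewrite -EFinB; congr EFin; field.
Qed.

Lemma negligible_bigcup_count (I : countType) (F : I -> set R) :
  (forall i, mu.-negligible (F i)) -> mu.-negligible (\bigcup_i F i).
Proof.
move=> F0; pose E k := if unpickle k is Some i then F i else set0.
apply: (@negligibleS _ _ _ mu (\bigcup_k E k)).
  by move=> y [i _ yi]; exists (pickle i) => //; rewrite /E pickleK.
apply: negligible_bigcup => k; rewrite /E; case: unpickle => [i|]; first exact: F0.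
exact: negligible_set0.
Qed.

(* 15 = 6 / (4 / 10): the covering dilates by 3 intervals of length 2 r, and each
   of them carries at least 4 / 10 r of the bound G. *)
Lemma slice_bound (T : R -> set R) (a b c d P : R) (G : R -> R -> R) :
  (forall y, measurable (T y)) ->
  (forall X : set R, measurable X -> measurable_fun setT (fun y => mu (T y `&` X))) ->
  (forall X : set R, measurable X -> measurable_fun setT (fun y => mu (~` T y `&` X))) ->
  (forall p q p' q', p < q -> p' < q' ->
    measurable_fun setT (fun y => wslice (T y) p q p' q')) ->
  (forall p q p' q' y r, p < q -> p' < q' -> a <= p -> q <= b -> a <= p' -> q' <= b ->
     0 < r -> c <= y - r -> y + r <= d ->
     \int[mu]_(t in setT) (trap (y - r) (y + r) (r / 2) t * wslice (T t) p q p' q') <= G y r) ->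
  (forall D : seq (R * {posnum R}), uniq D ->
     trivIset [set` D] (fun i => ball i.1 i.2%:num) ->
     (forall i, i \in D -> c <= i.1 - i.2%:num /\ i.1 + i.2%:num <= d) ->
     \sum_(i <- D) G i.1 i.2%:num <= P) ->
  (mu [set y | [/\ (c < y < d)%R, 0 < mu (T y `&` `]a, b[) & 0 < mu (~` T y `&` `]a, b[)]]
     <= (15 * P)%:E)%E.
Proof.
move=> mT mTX mCTX mw hG hP.
set N := [set y | _].
have mN : measurable N.
  rewrite (_ : N = `]c, d[%classic `&`
      ([set y | (0 < mu (T y `&` `]a, b[))%E] `&` [set y | (0 < mu (~` T y `&` `]a, b[))%E])); last first.
    by apply/seteqP; split => y; rewrite /N/= in_itv/=; [case|case=> ? []].
  apply: measurableI; first exact: measurable_itv.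
  have mpos (f : R -> \bar R) : measurable_fun setT f -> measurable [set y | (0 < f y)%E].
    move=> mf; rewrite -[X in measurable X]setTI.
    exact: emeasurable_fun_o_infty.
  by apply: measurableI; apply: mpos; [apply: mTX|apply: mCTX]; exact: measurable_itv.
(* The quadruple of endpoints depends on the slice, but it is rational: countably many functions
   [w i] arise, and almost every [y] is a Lebesgue point of all of them at once. *)
pose w (i : (rat * rat) * (rat * rat)) y :=
  wslice (T y) (ratr i.1.1) (ratr i.1.2) (ratr i.2.1) (ratr i.2.2).
pose good (i : (rat * rat) * (rat * rat)) :=
  (ratr i.1.1 < ratr i.1.2 :> R) && (ratr i.2.1 < ratr i.2.2 :> R).
pose bad i : set R := [set y | good i /\ ~ lebesgue_pt (w i) y].
have badneg i : mu.-negligible (bad i).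
  have [gi|ngi] := boolP (good i); last first.
    rewrite (_ : bad i = set0); first exact: negligible_set0.
    by rewrite -subset0 => y [gi _]; rewrite gi in ngi.
  have /andP[g1 g2] := gi.
  have /lebesgue_differentiation : locally_integrable setT (w i).
    apply: (@bounded_locally_integrable _ 1); first exact: mw.
    by move=> y; exact: wslice_norm1.
  by apply: negligibleS => y [_].
have [Z [mZ Z0 badZ]] : mu.-negligible (\bigcup_i bad i).
  exact: negligible_bigcup_count.
pose gd (i : R * {posnum R}) := [/\ c <= i.1 - i.2%:num, i.1 + i.2%:num <= d &
  4 / 10 * i.2%:num <= G i.1 i.2%:num].
have Ngood y : N y -> ~ Z y -> exists r : {posnum R}, gd (y, r).
  move=> [/andP[cy yd] T0 CT0] nZ.
  have [p [q [p' [q' [ap pq qb ap' [pq' qb' wy]]]]]] := impure_slice (mT y) T0 CT0.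
  pose i := ((p, q), (p', q')).
  have lpt : lebesgue_pt (w i) y.
    apply: contrapT => nl; apply: nZ; apply: badZ; exists i => //; split => //.
    by rewrite /good /= pq.
  have w1 t : `|w i t| <= 1 by exact: wslice_norm1.
  have mwi : measurable_fun setT (w i) by exact: mw.
  have e0 : 0 < 2 / 10 :> R by lra.
  have avg := lebesgue_pt_avg mwi w1 lpt e0.
  near (0 : R)^'+ => r.
  have r0 : 0 < r by [].
  have ravg : \int[mu]_(t in ball y r) `|w i t - w i y| <= 2 / 10 * r by near: r; exact: avg.
  have rc : r <= y - c by near: r; apply: nbhs_right_le; lra.
  have rd : r <= d - y by near: r; apply: nbhs_right_le; lra.
  have cyr : c <= y - r by move: rc; clear; lra.
  have yrd : y + r <= d by move: rd; clear; lra.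
  exists (PosNum r0); split; [exact: cyr|exact: yrd|].
  apply: le_trans (trap_integral_ge mwi w1 r0 wy ravg) _.
  exact: (hG _ _ _ _ _ _ pq pq' ap qb ap' qb' r0 cyr yrd).
(* The hypothesis [hP] speaks of finite disjoint families. A compact set needs finitely many good
   balls, Vitali makes them disjoint, and inner regularity then passes from compact subsets to the
   whole of [N] up to a null set. *)
have Kbound K : compact K -> K `<=` N `\` Z -> (mu K <= (15 * P)%:E)%E.
  move=> cK KN; pose B (i : R * {posnum R}) := ball i.1 i.2%:num.
  have : cover_compact K by rewrite -compact_cover.
  move=> /(_ (R * {posnum R})%type [set i | gd i] B)[].
  - by move=> i _; exact: ball_open.
  - move=> y Ky; have [Ny nZ] := KN y Ky; have [r gr] := Ngood y Ny nZ.
    by exists (y, r) => //; exact: ballxx.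
  move=> D Dgd KD.
  have Bball i : is_ball (B i) by exact: is_ball_ball.
  have B0 i : B i !=set0 by exists i.1; exact: ballxx.
  have [D' [uD' D'D tD' vit]] := vitali_lemma_finite Bball B0 (finmap.enum_fset D).
  have D'gd i : i \in D' -> gd i.
    by move=> /D'D iD; have /set_mem := Dgd i iD.
  have mB3 i : measurable (3 *` B i).
    by rewrite /B scale_ballE//; exact: measurable_ball.
  have mu3 i : mu (3 *` B i) = (6 * i.2%:num)%:E.
    rewrite /B scale_ballE// lebesgue_measure_ball; last by rewrite mulr_ge0.
    by congr EFin; rewrite -mulr_natr; ring.
  have sub3 (s : seq (R * {posnum R})) :
      measurable (\big[setU/set0]_(i <- s) (3 *` B i)) /\
      (mu (\big[setU/set0]_(i <- s) (3 *` B i)) <= (\sum_(i <- s) (6 * i.2%:num))%:E)%E.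
    elim: s => [|i s [ms hs]]; first by rewrite !big_nil measure0.
    rewrite !big_cons; split; first exact: measurableU.
    apply: (le_trans (measureU2 mu (mB3 i) ms)); rewrite EFinD; apply: leeD => //.
    by rewrite le_eqVlt; apply/orP; left; apply/eqP; exact: mu3.
  apply: (@le_trans _ _ (mu (\big[setU/set0]_(i <- D') (3 *` B i)))).
    apply: le_measure; rewrite ?inE//; [exact: compact_measurable|exact: (sub3 D').1|].
    move=> y /KD [i iD yi]; have [j [jD' _ _ ij]] := vit i iD.
    by rewrite -bigcup_seq; exists j => //; exact: ij.
  apply: le_trans (sub3 D').2 _; rewrite lee_fin.
  apply: (@le_trans _ _ (\sum_(i <- D') 15 * G i.1 i.2%:num)).
    rewrite big_seq [leRHS]big_seq; apply: ler_sum => i /D'gd[_ _ h].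
    have aux (u v : R) : 4 / 10 * u <= v -> 6 * u <= 15 * v by clear; lra.
    exact: aux.
  rewrite -mulr_sumr ler_wpM2l//; apply: hP => // i /D'gd[h1 h2 _]; split => //.
have NZ : (mu N <= mu (N `\` Z))%E.
  rewrite (measureDI mu mN mZ) -[leRHS]adde0; apply: leeD; first exact: lexx.
  by rewrite -Z0; apply: le_measure; rewrite ?inE//; exact: measurableI.
apply: le_trans NZ _; apply/lee_addgt0Pr => e e0.
have mNZ : measurable (N `\` Z) by exact: measurableD.
have NZoo : (mu (N `\` Z) < +oo)%E.
  apply: (@le_lt_trans _ _ (mu `]c, d[%classic)).
    apply: le_measure; rewrite ?inE//.
    by move=> y [[cyd _ _] _]; rewrite /= in_itv.
  by rewrite lebesgue_measure_itv/=; case: ifP => _; rewrite -?EFinB ltry.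
have [K [cK KN Ke]] := lebesgue_regularity_inner mNZ NZoo e0.
have mK : measurable K by exact: compact_measurable.
rewrite -(setDKU KN).
apply: (le_trans (measureU2 mu (measurableD mNZ mK) mK)).
by rewrite addeC; apply: leeD; [exact: Kbound|exact: ltW].
Unshelve. all: by end_near. Qed.

End slicing.

(** * The perimeter inside a subset of the plane *)

Section local_perimeter.
Context {R : realType}.
Variables (S : set (R * R)) (M : R).
Hypothesis mS : lebesgue2_measurable S.
Hypothesis SM : forall phi, test_field phi -> flux S phi <= M.
Implicit Types (phi psi : R * R -> R * R) (Q : set (R * R)).

Definition supported phi Q := forall x, ~ Q x -> phi x = 0.

Definition local_perimeter Q : R :=
  sup [set flux S phi | phi in [set phi | test_field phi /\ supported phi Q]].

Lemma local_perimeter_has_sup Q :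
  has_sup [set flux S phi | phi in [set phi | test_field phi /\ supported phi Q]].
Proof.
split; last by exists M => _ [phi [tphi _] <-]; exact: SM.
by exists 0; exists (fun=> (0, 0)); [split => //; exact: test_field0|exact: flux0].
Qed.

Lemma local_perimeter_ge Q phi : test_field phi -> supported phi Q ->
  flux S phi <= local_perimeter Q.
Proof.
move=> tphi sphi; apply: ub_le_sup; first by have [] := local_perimeter_has_sup Q.
by exists phi.
Qed.

Lemma local_perimeter_le Q (m : R) :
  (forall phi, test_field phi -> supported phi Q -> flux S phi <= m) ->
  local_perimeter Q <= m.
Proof.
move=> h; apply: ge_sup; first by have [] := local_perimeter_has_sup Q.
by move=> _ [phi [tphi sphi] <-]; exact: h.
Qed.

Lemma local_perimeter_ge0 Q : 0 <= local_perimeter Q.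
Proof.
rewrite -[leLHS](flux0 S); apply: local_perimeter_ge; first exact: test_field0.
by [].
Qed.

Lemma local_perimeterS Q Q' : Q `<=` Q' -> local_perimeter Q <= local_perimeter Q'.
Proof.
move=> QQ'; apply: local_perimeter_le => phi tphi sphi.
by apply: local_perimeter_ge => // x nx; apply: sphi => Qx; apply: nx; exact: QQ'.
Qed.

Lemma local_perimeterD Q Q' : Q `&` Q' = set0 ->
  local_perimeter Q + local_perimeter Q' <= local_perimeter (Q `|` Q').
Proof.
move=> QQ'; rewrite -lerBrDr; apply: local_perimeter_le => phi tphi sphi.
rewrite lerBrDr addrC -lerBrDr; apply: local_perimeter_le => psi tpsi spsi.
rewrite lerBrDr addrC -(fluxD mS tphi tpsi); apply: local_perimeter_ge.
  exact: (test_fieldD_disjoint tphi tpsi QQ').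
move=> x nx; rewrite /= sphi ?spsi ?addr0//.
  by move=> Qx; apply: nx; right.
by move=> Qx; apply: nx; left.
Qed.

Lemma local_perimeter_sum (I : eqType) (s : seq I) (F : I -> set (R * R)) Q :
  uniq s -> (forall i, i \in s -> F i `<=` Q) ->
  (forall i j, i \in s -> j \in s -> i != j -> F i `&` F j = set0) ->
  \sum_(i <- s) local_perimeter (F i) <= local_perimeter Q.
Proof.
elim: s Q => [|i s IHs] Q; first by rewrite big_nil local_perimeter_ge0.
rewrite big_cons/= => /andP[iNs us] FQ dF.
apply: (@le_trans _ _ (local_perimeter (F i) + local_perimeter (\bigcup_(j in [set` s]) F j))).
  rewrite lerD2l; apply: IHs => //.
    by move=> j js x Fjx; exists j.
  by move=> j k js ks; apply: dF; rewrite inE ?js ?ks orbT.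
apply: le_trans (local_perimeterD _) _.
  rewrite setI_bigcupr; apply: bigcup0 => j js.
  apply: dF; rewrite ?mem_head ?inE ?js ?orbT//.
  by apply: contraNneq iNs => ->.
apply: local_perimeterS => x [Fix|[j js Fjx]]; first exact: (FQ i (mem_head _ _)).
by apply: (FQ j) => //; rewrite inE js orbT.
Qed.

End local_perimeter.

(** * Fluxes of product fields as integrals over slices *)

Section fubini.
Context {R : realType}.
Notation mu := (@lebesgue_measure R).
Notation mu2 := (mu \x mu)%E.
Notation L2 := (@lebesgue2 R).
Notation rT := (measurableTypeR R).
Notation plane := (rT * rT)%type.
Variables (S : set (R * R)) (u v : R -> R) (a b c d K K' : R).
Hypotheses (mS : measurable S) (mu_ : measurable_fun setT u) (mv : measurable_fun setT v).
Hypotheses (uK : forall x, `|u x| <= K) (vK : forall x, `|v x| <= K').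
Hypotheses (u0 : forall x, ~ `]a, b[%classic x -> u x = 0).
Hypotheses (v0 : forall x, ~ `]c, d[%classic x -> v x = 0).

Let F (x : R * R) : R := u x.1 * v x.2 * \1_S x.

Let mF : measurable_fun setT F.
Proof.
apply: measurable_funM; last exact: measurable_indic.
apply: measurable_funM.
  exact: (measurableT_comp mu_ measurable_fst).
exact: (measurableT_comp mv measurable_snd).
Qed.

Let itv_lty (x y : R) : (mu `]x, y[%classic < +oo)%E.
Proof. by rewrite lebesgue_measure_itv/=; case: ifP => _; rewrite -?EFinB ltry. Qed.

Let intF : mu2.-integrable setT (EFin \o F).
Proof.
have mB : measurable (`]a, b[ `*` `]c, d[ : set plane) by exact: measurableX.
have Boo : (mu2 (`]a, b[ `*` `]c, d[)%classic < +oo)%E.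
  rewrite product_measure1E; [|exact: measurable_itv|exact: measurable_itv].
  apply: lte_mul_pinfty; [exact: measure_ge0| |exact: itv_lty].
  by rewrite ge0_fin_numE; [exact: itv_lty|exact: measure_ge0].
apply: (@integrable_bounded_support _ plane R mu2 setT _ F (K * K') measurableT mB Boo mF).
- move=> x _; rewrite /F normrM -[leRHS]mulr1 ler_pM//.
    by rewrite normrM ler_pM.
  by rewrite indicE; case: (_ \in _); rewrite ?normr1 ?normr0.
- move=> x nx; rewrite /F; have [x1|/u0 ->] := pselect (`]a, b[%classic x.1).
    by rewrite v0 ?mulr0 ?mul0r// => x2; exact: nx.
  by rewrite !mul0r.
Qed.

Let bigE : (\int[L2]_(x in S) (u x.1 * v x.2)%:E = \int[mu2]_x (F x)%:E)%E.
Proof.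
rewrite integral_mkcond -(integral_lebesgue2 intF).
apply: eq_integral => x _; rewrite patchE/= /F indicE.
by case: ifP => _; rewrite ?mulr1 ?mulr0.
Qed.

Let int_u (A : set rT) : measurable A -> mu.-integrable A (EFin \o u).
Proof.
move=> mA; have mI : measurable (`]a, b[%classic : set rT) by exact: measurable_itv.
exact: (integrable_bounded_support mA mI (itv_lty a b) mu_ (fun x _ => uK x) u0).
Qed.

Let int_v (A : set rT) : measurable A -> mu.-integrable A (EFin \o v).
Proof.
move=> mA; have mI : measurable (`]c, d[%classic : set rT) by exact: measurable_itv.
exact: (integrable_bounded_support mA mI (itv_lty c d) mv (fun x _ => vK x) v0).
Qed.

Lemma Rintegral_fubini_y : \int[L2]_(x in S) (u x.1 * v x.2) =
  \int[mu]_(t in setT) (v t * \int[mu]_(s in ysection S t) u s).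
Proof.
rewrite /Rintegral bigE -(integral21_prod_meas1 intF); congr fine.
apply: eq_integral => t _; rewrite /fubini_G/=.
have mSt : measurable (ysection S t : set rT) by exact: measurable_ysection.
rewrite EFinM fineK; last exact: (integrable_fin_num mSt (int_u mSt)).
rewrite -(integralZl mSt (int_u mSt)) [RHS]integral_mkcond.
apply: eq_integral => s _; rewrite patchE /F indicE /= mem_ysection.
by case: ifP => _; rewrite ?mulr1 ?mulr0// mulrC.
Qed.

Lemma Rintegral_fubini_x : \int[L2]_(x in S) (u x.1 * v x.2) =
  \int[mu]_(t in setT) (u t * \int[mu]_(s in xsection S t) v s).
Proof.
rewrite /Rintegral bigE -(integral12_prod_meas1 intF); congr fine.
apply: eq_integral => t _; rewrite /fubini_F/=.
have mSt : measurable (xsection S t : set rT) by exact: measurable_xsection.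
rewrite EFinM fineK; last exact: (integrable_fin_num mSt (int_v mSt)).
rewrite -(integralZl mSt (int_v mSt)) [RHS]integral_mkcond.
apply: eq_integral => s _; rewrite patchE /F indicE /= mem_xsection.
by case: ifP => _; rewrite ?mulr1 ?mulr0.
Qed.

End fubini.

Section section_measurability.
Context {R : realType}.
Notation mu := (@lebesgue_measure R).
Notation rT := (measurableTypeR R).
Notation plane := (rT * rT)%type.
Variable S : set (R * R).
Hypothesis mS : measurable S.

Lemma measurable_ysection_measure (X : set R) : measurable X ->
  measurable_fun setT (fun y => mu (ysection S y `&` X)).
Proof.
move=> mX; have mSX : measurable (S `&` (X `*` setT) : set plane).
  by apply: measurableI => //; exact: measurableX.
rewrite (_ : (fun y => _) = mu \o ysection (S `&` (X `*` setT))).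
  exact: measurable_fun_ysection.
apply/funext => y /=; congr (mu _); apply/seteqP; split => x.
  by move=> [/xsectionP Sxy Xx]; apply/ysectionP; split => //; apply/ysectionP.
by move=> /ysectionP[Sxy [Xx _]]; split => //; apply/ysectionP.
Qed.

Lemma measurable_xsection_measure (X : set R) : measurable X ->
  measurable_fun setT (fun y => mu (xsection S y `&` X)).
Proof.
move=> mX; have mSX : measurable (S `&` (setT `*` X) : set plane).
  by apply: measurableI => //; exact: measurableX.
rewrite (_ : (fun y => _) = mu \o xsection (S `&` (setT `*` X))).
  exact: measurable_fun_xsection.
apply/funext => y /=; congr (mu _); apply/seteqP; split => x.
  by move=> [/xsectionP Sxy Xx]; apply/xsectionP; split.
by move=> /xsectionP[Sxy [_ Xx]]; split => //; apply/xsectionP.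
Qed.

Lemma measurable_ysection_dstep (p q : R) : p < q ->
  measurable_fun setT (fun y => \int[mu]_(x in ysection S y) dstep p q x).
Proof.
move=> pq; pose f (x : plane) := (dstep p q x.1 * \1_S x)%:E.
have mf : measurable_fun setT f.
  apply/measurable_EFinP; apply: measurable_funM; last exact: measurable_indic.
  exact: (measurableT_comp (@measurable_dstep _ p q) measurable_fst).
have f0 x : (0 <= f x)%E.
  rewrite lee_fin mulr_ge0//.
  by have /andP[] := dstep_bound x.1 pq.
have mG := @measurable_fun_fubini_tonelli_G _ _ rT rT R mu f mf f0.
have gE : (fun y => \int[mu]_(x in ysection S y) (dstep p q x)%:E)%E = fubini_G mu f.
  apply/funext => y; rewrite integral_mkcond; apply: eq_integral => x _.
  by rewrite patchE /f/= indicE mem_ysection; case: ifP => _; rewrite ?mulr1 ?mulr0.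
rewrite -gE in mG.
exact: (measurableT_comp (fine_measurable (@measurableT _ (\bar R))) mG).
Qed.

Lemma measurable_xsection_dstep (p q : R) : p < q ->
  measurable_fun setT (fun y => \int[mu]_(x in xsection S y) dstep p q x).
Proof.
move=> pq; pose f (x : plane) := (dstep p q x.2 * \1_S x)%:E.
have mf : measurable_fun setT f.
  apply/measurable_EFinP; apply: measurable_funM; last exact: measurable_indic.
  exact: (measurableT_comp (@measurable_dstep _ p q) measurable_snd).
have f0 x : (0 <= f x)%E.
  rewrite lee_fin mulr_ge0//.
  by have /andP[] := dstep_bound x.2 pq.
have mG := @measurable_fun_fubini_tonelli_F _ _ rT rT R mu f mf f0.
have gE : (fun y => \int[mu]_(x in xsection S y) (dstep p q x)%:E)%E = fubini_F mu f.
  apply/funext => y; rewrite integral_mkcond; apply: eq_integral => x _.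
  by rewrite patchE /f/= indicE mem_xsection; case: ifP => _; rewrite ?mulr1 ?mulr0.
rewrite -gE in mG.
exact: (measurableT_comp (fine_measurable (@measurableT _ (\bar R))) mG).
Qed.

End section_measurability.

Lemma ysectionC T1 T2 (A : set (T1 * T2)) y : ysection (~` A) y = ~` ysection A y.
Proof.
apply/seteqP; split => x; first by move=> /ysectionP nA /ysectionP.
by move=> nA; apply/ysectionP => Axy; apply: nA; apply/ysectionP.
Qed.

Lemma xsectionC T1 T2 (A : set (T1 * T2)) x : xsection (~` A) x = ~` xsection A x.
Proof.
apply/seteqP; split => y; first by move=> /xsectionP nA /xsectionP.
by move=> nA; apply/xsectionP => Axy; apply: nA; apply/xsectionP.
Qed.

(** * Measure of the impure rows and columns *)

Section impure.
Context {R : realType}.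
Notation mu := (@lebesgue_measure R).
Notation rT := (measurableTypeR R).
Notation L2 := (@lebesgue2 R).
Variables (S : set (R * R)) (M : R).
Hypothesis mS : measurable S.
Hypothesis SM : forall phi, test_field phi -> flux S phi <= M.

(** Both steps go from 0 to 1, so their difference is bounded by 1 and vanishes outside every
    interval containing the two ramps; the integral of its derivative over a slice is [wslice]. *)
Definition hat (p q p' q' x : R) := step p q x + - 1 * step p' q' x.
Definition dhat (p q p' q' x : R) := dstep p q x + - 1 * dstep p' q' x.

Lemma C1line_hat p q p' q' : C1line (hat p q p' q') (dhat p q p' q').
Proof. by apply: C1lineD; last apply: C1lineZ; exact: C1line_step. Qed.

Lemma hat_norm1 p q p' q' x : `|hat p q p' q' x| <= 1.
Proof.
have /andP[a0 a1] := step01 p q x; have /andP[b0 b1] := step01 p' q' x.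
by rewrite /hat ler_norml; apply/andP; split; lra.
Qed.

Lemma hat_out a b p q p' q' x : p < q -> p' < q' -> a <= p -> q <= b -> a <= p' -> q' <= b ->
  ~ `]a, b[%classic x -> hat p q p' q' x = 0.
Proof.
move=> pq pq' ap qb ap' qb' xab; rewrite /hat.
have [xa|xa] := leP x a.
  by rewrite !step_le ?mulr0 ?addr0//; apply: le_trans xa _.
have bx : b <= x by rewrite leNgt; apply/negP => xb; apply: xab; rewrite /= in_itv/= xa.
rewrite !step_ge ?mulr1 ?subrr//; exact: (le_trans _ bx).
Qed.

Lemma dhat_out a b p q p' q' x : p < q -> p' < q' -> a <= p -> q <= b -> a <= p' -> q' <= b ->
  ~ `]a, b[%classic x -> dhat p q p' q' x = 0.
Proof.
move=> pq pq' ap qb ap' qb' xab; rewrite /dhat !dstep_out ?mulr0 ?addr0//.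
  by move=> xpq; apply: xab; move: xpq; rewrite /= !in_itv/= => /andP[? ?]; apply/andP; split;
    [exact: le_lt_trans ap' _|exact: lt_le_trans _ qb'].
by move=> xpq; apply: xab; move: xpq; rewrite /= !in_itv/= => /andP[? ?]; apply/andP; split;
    [exact: le_lt_trans ap _|exact: lt_le_trans _ qb].
Qed.

Lemma dhat_bound p q p' q' x : p < q -> p' < q' ->
  `|dhat p q p' q' x| <= 2 / (q - p) + 2 / (q' - p').
Proof.
move=> pq pq'; have /andP[a0 a1] := dstep_bound x pq; have /andP[b0 b1] := dstep_bound x pq'.
rewrite /dhat mulN1r; apply: le_trans (ler_normB _ _) _.
by rewrite !ger0_norm//; exact: lerD.
Qed.

Lemma Rintegral_dhat (T : set R) p q p' q' : measurable T -> p < q -> p' < q' ->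
  \int[mu]_(x in T) dhat p q p' q' x = wslice T p q p' q'.
Proof.
move=> mT pq pq'; have mT' : measurable (T : set rT) := mT.
rewrite /wslice -(RintegralB mT' (integrable_dstep pq mT) (integrable_dstep pq' mT)).
by apply: eq_Rintegral => x _; rewrite /dhat mulN1r.
Qed.

Lemma measurable_C1line f f' : @C1line R f f' -> measurable_fun setT f'.
Proof. by move=> [_ cf]; exact: continuous_measurable_fun. Qed.

Section fields.
Variables (f f' g g' : R -> R) (a b c d : R).
Hypotheses (Cf : C1line f f') (Cg : C1line g g').
Hypotheses (f1 : forall x, `|f x| <= 1) (g1 : forall x, `|g x| <= 1).
Hypotheses (f0 : forall x, ~ `]a, b[%classic x -> f x = 0).
Hypotheses (g0 : forall x, ~ `]c, d[%classic x -> g x = 0).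

Let fg (x : R * R) := f x.1 * g x.2.

Let Cfg : C1fun fg.
Proof. exact: (C1funM (C1fun_comp_fst Cf) (C1fun_comp_snd Cg)). Qed.

Let fg_sq x : fg x ^+ 2 <= 1.
Proof.
rewrite -[leLHS]ger0_norm ?sqr_ge0// normrX exprn_ile1//.
by rewrite normrM mulr_ile1.
Qed.

Let fg_supp : exists r, forall x, ~ boxn r x -> fg x = 0.
Proof.
exists (`|a| + `|b| + `|c| + `|d|) => x xr; rewrite /fg.
have [x1|/f0->] := pselect (`]a, b[%classic x.1); last by rewrite mul0r.
rewrite g0 ?mulr0// => x2; apply: xr; move: x1 x2; rewrite /boxn/= !in_itv/=.
have := ler_norm a; have := ler_norm b; have := ler_norm c; have := ler_norm d.
have := ler_norm (- a); have := ler_norm (- b); have := ler_norm (- c); have := ler_norm (- d).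
rewrite !normrN; move: x.1 x.2 (`|a|) (`|b|) (`|c|) (`|d|); clear.
by move=> *; split; lra.
Qed.

Lemma test_field_h : test_field (fun x => (fg x, 0)).
Proof.
have [r hr] := fg_supp; apply: (@mk_test_field _ _ _ r) => //.
- exact: C1fun_cst.
- by move=> x /hr ->.
- by move=> x; rewrite expr0n addr0; exact: fg_sq.
Qed.

Lemma test_field_v : test_field (fun x => (0, fg x)).
Proof.
have [r hr] := fg_supp; apply: (@mk_test_field _ _ _ r) => //.
- exact: C1fun_cst.
- by move=> x /hr ->.
- by move=> x; rewrite expr0n add0r; exact: fg_sq.
Qed.

Lemma div2_h x : div2 (fun x => (fg x, 0)) x = f' x.1 * g x.2.
Proof.
have [[dphi _] _ _] := test_field_h; rewrite div2E//= derive_cst addr0.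
rewrite (deriveMC1 _ _ (C1fun_comp_fst Cf) (C1fun_comp_snd Cg)).
by rewrite (derive_comp_fst _ _ Cf) (derive_comp_snd _ _ Cg)/= mul0r mulr0 add0r mul1r mulrC.
Qed.

Lemma div2_v x : div2 (fun x => (0, fg x)) x = f x.1 * g' x.2.
Proof.
have [[dphi _] _ _] := test_field_v; rewrite div2E//= derive_cst add0r.
rewrite (deriveMC1 _ _ (C1fun_comp_fst Cf) (C1fun_comp_snd Cg)).
by rewrite (derive_comp_fst _ _ Cf) (derive_comp_snd _ _ Cg)/= mul0r mulr0 addr0 mul1r.
Qed.

Lemma supported_fg : forall x, ~ (`]a, b[ `*` `]c, d[)%classic x -> fg x = 0.
Proof.
move=> x nx; rewrite /fg; have [x1|/f0->] := pselect (`]a, b[%classic x.1); last by rewrite mul0r.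
by rewrite g0 ?mulr0// => x2; exact: nx.
Qed.

End fields.

(** A horizontal field, [hat] in the abscissa times [trap] in the ordinate, vanishes outside a strip
    of rows around [y], and by Fubini its flux is the integral that [slice_bound] asks to control.
    So the local perimeter of the strip serves as [G]: disjoint balls of ordinates give disjoint
    strips, whose local perimeters sum to at most that of the box. *)
Lemma impure_rows a b c d :
  (mu [set y | [/\ (c < y < d)%R, 0 < mu (ysection S y `&` `]a, b[) &
                0 < mu (~` ysection S y `&` `]a, b[)]] <=
   (15 * local_perimeter S (box a b c d))%:E)%E.
Proof.
have mS2 := lebesgue2_measurable_borel mS.
apply: (@slice_bound _ _ a b c d _ (fun y r => local_perimeter S (box a b (y - r) (y + r)))).
- by move=> y; exact: measurable_ysection.
- exact: measurable_ysection_measure.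
- move=> X mX; rewrite (_ : (fun y => mu _) = fun y => mu (ysection (~` S) y `&` X)).
    exact: (measurable_ysection_measure (measurableC mS) mX).
  by apply/funext => y; rewrite ysectionC.
- move=> p q p' q' pq pq'; apply: measurable_funB; exact: measurable_ysection_dstep.
- move=> p q p' q' y r pq pq' ap qb ap' qb' r0 cy yd.
  have r20 : 0 < r / 2 by lra.
  have rr : y - r + r / 2 <= y + r - r / 2 by lra.
  have Cf := C1line_hat p q p' q'; have Cg := C1line_trap (y - r) (y + r) (r / 2).
  have g1 t : `|trap (y - r) (y + r) (r / 2) t| <= 1.
    by have /andP[t0 t1] := trap01 t r20 rr; rewrite ger0_norm.
  have f0 x (h : ~ `]a, b[%classic x) := hat_out pq pq' ap qb ap' qb' h.
  have df0 x (h : ~ `]a, b[%classic x) := dhat_out pq pq' ap qb ap' qb' h.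
  have g0 x (h : ~ `]y - r, y + r[%classic x) := trap_out r20 rr h.
  have tphi := test_field_h Cf Cg (hat_norm1 _ _ _ _) g1 f0 g0.
  have sphi : supported (fun x => (hat p q p' q' x.1 * trap (y - r) (y + r) (r / 2) x.2, 0))
     (box a b (y - r) (y + r)).
    by move=> x nx; rewrite (supported_fg f0 g0 nx).
  apply: le_trans (local_perimeter_ge SM tphi sphi).
  rewrite le_eqVlt; apply/orP; left; apply/eqP; apply/esym.
  transitivity (\int[L2]_(x in S) (dhat p q p' q' x.1 * trap (y - r) (y + r) (r / 2) x.2)).
    apply: eq_Rintegral => x _.
    exact: (div2_h Cf Cg (hat_norm1 _ _ _ _) g1 f0 g0).
  rewrite (Rintegral_fubini_y mS (measurable_C1line Cf) (measurable_trap _ _ _)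
    (fun x => dhat_bound x pq pq') g1 df0 g0).
  apply: eq_Rintegral => t _; rewrite Rintegral_dhat//.
  exact: measurable_ysection.
- move=> D uD tD hD; apply: (local_perimeter_sum mS2 SM uD).
    by move=> i /hD[h1 h2] x [/=]; rewrite !in_itv/= => x1 x2; split; rewrite /= in_itv//=;
      lra.
  move=> i j iD jD ij; rewrite -subset0 => x [[_ xi] [_ xj]].
  move/trivIsetP : tD => /(_ i j iD jD ij) h; rewrite -[set0]/(@set0 R) in h *.
  have : (ball i.1 i.2%:num `&` ball j.1 j.2%:num) x.2.
    by split; apply/mem_ball; [move: xi|move: xj]; rewrite /= in_itv.
  by rewrite h.
Qed.

(** The same argument with vertical fields and the other order of integration. *)
Lemma impure_cols a b c d :
  (mu [set x | [/\ (a < x < b)%R, 0 < mu (xsection S x `&` `]c, d[) &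
                0 < mu (~` xsection S x `&` `]c, d[)]] <=
   (15 * local_perimeter S (box a b c d))%:E)%E.
Proof.
have mS2 := lebesgue2_measurable_borel mS.
apply: (@slice_bound _ _ c d a b _ (fun y r => local_perimeter S (box (y - r) (y + r) c d))).
- by move=> y; exact: measurable_xsection.
- exact: measurable_xsection_measure.
- move=> X mX; rewrite (_ : (fun y => mu _) = fun y => mu (xsection (~` S) y `&` X)).
    exact: (measurable_xsection_measure (measurableC mS) mX).
  by apply/funext => y; rewrite xsectionC.
- move=> p q p' q' pq pq'; apply: measurable_funB; exact: measurable_xsection_dstep.
- move=> p q p' q' y r pq pq' ap qb ap' qb' r0 cy yd.
  have r20 : 0 < r / 2 by lra.
  have rr : y - r + r / 2 <= y + r - r / 2 by lra.
  have Cf := C1line_hat p q p' q'; have Cg := C1line_trap (y - r) (y + r) (r / 2).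
  have g1 t : `|trap (y - r) (y + r) (r / 2) t| <= 1.
    by have /andP[t0 t1] := trap01 t r20 rr; rewrite ger0_norm.
  have f0 x (h : ~ `]c, d[%classic x) := hat_out pq pq' ap qb ap' qb' h.
  have df0 x (h : ~ `]c, d[%classic x) := dhat_out pq pq' ap qb ap' qb' h.
  have g0 x (h : ~ `]y - r, y + r[%classic x) := trap_out r20 rr h.
  have tphi := test_field_v Cg Cf g1 (hat_norm1 _ _ _ _) g0 f0.
  have sphi : supported (fun x => (0, trap (y - r) (y + r) (r / 2) x.1 * hat p q p' q' x.2))
     (box (y - r) (y + r) c d).
    by move=> x nx; rewrite (supported_fg g0 f0 nx).
  apply: le_trans (local_perimeter_ge SM tphi sphi).
  rewrite le_eqVlt; apply/orP; left; apply/eqP; apply/esym.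
  transitivity (\int[L2]_(x in S) (trap (y - r) (y + r) (r / 2) x.1 * dhat p q p' q' x.2)).
    apply: eq_Rintegral => x _.
    exact: (div2_v Cg Cf g1 (hat_norm1 _ _ _ _) g0 f0).
  rewrite (Rintegral_fubini_x mS (measurable_trap _ _ _) (measurable_C1line Cf)
    g1 (fun x => dhat_bound x pq pq') g0 df0).
  apply: eq_Rintegral => t _; rewrite Rintegral_dhat//.
  exact: measurable_xsection.
- move=> D uD tD hD; apply: (local_perimeter_sum mS2 SM uD).
    by move=> i /hD[h1 h2] x [/=]; rewrite !in_itv/= => x1 x2; split; rewrite /= in_itv//=;
      lra.
  move=> i j iD jD ij; rewrite -subset0 => x [[xi _] [xj _]].
  move/trivIsetP : tD => /(_ i j iD jD ij) h.
  have : (ball i.1 i.2%:num `&` ball j.1 j.2%:num) x.1.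
    by split; apply/mem_ball; [move: xi|move: xj]; rewrite /= in_itv.
  by rewrite h.
Qed.

End impure.

(** * The square estimate *)

Section sections.
Context {R : realType}.
Notation mu := (@lebesgue_measure R).
Notation rT := (measurableTypeR R).
Notation L2 := (@lebesgue2 R).

Lemma lebesgue2_xsections (A : set (R * R)) : measurable A ->
  L2 A = (\int[mu]_x mu (xsection A x))%E.
Proof. by move=> mA; rewrite lebesgue2E. Qed.

Lemma lebesgue2_ysections (A : set (R * R)) : measurable A ->
  L2 A = (\int[mu]_y mu (ysection A y))%E.
Proof.
move=> mA; rewrite lebesgue2_xsections//.
have := @indic_fubini_tonelli _ _ rT rT R mu mu A mA.
by rewrite indic_fubini_tonelli_FE// indic_fubini_tonelli_GE.
Qed.

Variable S : set (R * R).
Hypothesis mS : measurable S.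

(** The gap is zero exactly on the full rows. It is bounded by the length of the interval, so [fine]
    loses nothing and Lebesgue differentiation applies. *)
Definition row_gap (a b y : R) : R := fine (mu (~` ysection S y `&` `]a, b[)).
Definition col_gap (c d x : R) : R := fine (mu (~` xsection S x `&` `]c, d[)).

Lemma measurable_ysection_R y : measurable (ysection S y : set R).
Proof. exact: measurable_ysection. Qed.

Lemma measurable_xsection_R x : measurable (xsection S x : set R).
Proof. exact: measurable_xsection. Qed.

Lemma gap_fin (T : set R) (a b : R) : measurable T -> mu (T `&` `]a, b[) \is a fin_num.
Proof.
move=> mT; rewrite ge0_fin_numE//; apply: le_lt_trans (itv_measure_lty a b).
by apply: le_measure; rewrite ?inE//; exact: measurableI.
Qed.

Lemma gap_le (T : set R) (a b : R) : measurable T ->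
  `|fine (mu (T `&` `]a, b[))| <= fine (mu `]a, b[%classic).
Proof.
move=> mT; rewrite ger0_norm ?fine_ge0// fine_le//.
- exact: gap_fin.
- by rewrite ge0_fin_numE//; exact: itv_measure_lty.
- by apply: le_measure; rewrite ?inE//; exact: measurableI.
Qed.

Lemma row_gapE a b y : (row_gap a b y)%:E = mu (~` ysection S y `&` `]a, b[).
Proof. by rewrite fineK// gap_fin//; apply: measurableC; exact: measurable_ysection_R. Qed.

Lemma col_gapE a b x : (col_gap a b x)%:E = mu (~` xsection S x `&` `]a, b[).
Proof. by rewrite fineK// gap_fin//; apply: measurableC; exact: measurable_xsection_R. Qed.

Lemma measurable_row_gap a b : measurable_fun setT (row_gap a b).
Proof.
have h : measurable_fun setT (fun y => mu (~` ysection S y `&` `]a, b[)).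
  rewrite (_ : (fun y => mu _) = fun y => mu (ysection (~` S) y `&` `]a, b[)).
    exact: (measurable_ysection_measure (measurableC mS) (measurable_itv _)).
  by apply/funext => y; rewrite ysectionC.
exact: (measurableT_comp (fine_measurable (@measurableT _ (\bar R))) h).
Qed.

Lemma measurable_col_gap a b : measurable_fun setT (col_gap a b).
Proof.
have h : measurable_fun setT (fun y => mu (~` xsection S y `&` `]a, b[)).
  rewrite (_ : (fun y => mu _) = fun y => mu (xsection (~` S) y `&` `]a, b[)).
    exact: (measurable_xsection_measure (measurableC mS) (measurable_itv _)).
  by apply/funext => y; rewrite xsectionC.
exact: (measurableT_comp (fine_measurable (@measurableT _ (\bar R))) h).
Qed.

Lemma gap_lebesgue_pt (g : R -> R) (K : R) : measurable_fun setT g ->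
  (forall x, `|g x| <= K) -> {ae mu, forall y, lebesgue_pt g y}.
Proof. by move=> mg gK; apply: lebesgue_differentiation; exact: bounded_locally_integrable gK. Qed.

Lemma thin_avg (g : R -> R) (K y e : R) : measurable_fun setT g ->
  (forall x, 0 <= g x <= K) -> lebesgue_pt g y -> g y = 0 -> 0 < e ->
  \forall r \near 0^'+, (\int[mu]_(t in ball y r) (g t)%:E <= (e * r)%:E)%E.
Proof.
move=> mg gK lpt gy e0.
have gK' x : `|g x| <= K by have /andP[g0 ?] := gK x; rewrite ger0_norm.
have avg := lebesgue_pt_avg mg gK' lpt e0.
near=> r; have r0 : 0 < r by [].
have : \int[mu]_(t in ball y r) `|g t - g y| <= e * r by near: r; exact: avg.
have mb : measurable (ball y r : set rT) by exact: measurable_ball.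
have boo : (mu (ball y r) < +oo)%E by rewrite lebesgue_measure_ball ?ltry// ltW.
have intg : mu.-integrable (ball y r) (EFin \o g).
  apply: (@measurable_bounded_integrable _ rT R mu _ _ mb boo); first exact: measurable_funTS.
  exists K; split; first exact: num_real.
  by move=> m m2 t _; exact: (le_trans (gK' t) (ltW m2)).
rewrite (@eq_Rintegral _ _ _ mu _ g); last first.
  by move=> t _; rewrite gy subr0 ger0_norm//; have /andP[] := gK t.
by rewrite -lee_fin /Rintegral fineK//; exact: (integrable_fin_num mb intg).
Unshelve. all: by end_near. Qed.

Lemma row_gap_bound a b y : 0 <= row_gap a b y <= fine (mu `]a, b[%classic).
Proof.
rewrite fine_ge0//=; apply: le_trans (ler_norm _) (gap_le _ _ _).
by apply: measurableC; exact: measurable_ysection_R.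
Qed.

Lemma col_gap_bound a b y : 0 <= col_gap a b y <= fine (mu `]a, b[%classic).
Proof.
rewrite fine_ge0//=; apply: le_trans (ler_norm _) (gap_le _ _ _).
by apply: measurableC; exact: measurable_xsection_R.
Qed.

(** A full row may be surrounded by rows that are not full. By Fubini the complement of [S] has in
    the strip a measure equal to the integral of the gap, and this is $o(r)$ at a Lebesgue point
    where the gap vanishes. *)
Lemma thin_row a b y e : lebesgue_pt (row_gap a b) y -> row_gap a b y = 0 -> 0 < e ->
  \forall r \near 0^'+, (L2 (~` S `&` (`]a, b[ `*` ball y r)) <= (e * r)%:E)%E.
Proof.
move=> lpt gy e0; have := thin_avg (measurable_row_gap a b) (row_gap_bound a b) lpt gy e0.
apply: filterS => r; apply: le_trans.
have mb : measurable (ball y r : set R) by exact: measurable_ball.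
rewrite lebesgue2_ysections; last first.
  by apply: measurableI; [exact: measurableC|exact: measurableX].
rewrite [leRHS]integral_mkcond le_eqVlt; apply/orP; left; apply/eqP.
apply: eq_integral => t _; rewrite patchE; case: ifPn => [|] tb.
  rewrite row_gapE; congr (mu _); apply/seteqP; split => x.
    by move=> /ysectionP[/= nS [xab _]]; split => // /ysectionP.
  move=> [nS xab]; apply/ysectionP; split; first by move=> Sx; apply: nS; apply/ysectionP.
  by split => //=; rewrite inE in tb.
rewrite (_ : ysection _ _ = set0) ?measure0// -subset0 => x /ysectionP[_ [_ /= tb']].
by move: tb; rewrite notin_setE.
Qed.

Lemma thin_col c d x e : lebesgue_pt (col_gap c d) x -> col_gap c d x = 0 -> 0 < e ->
  \forall r \near 0^'+, (L2 (~` S `&` (ball x r `*` `]c, d[)) <= (e * r)%:E)%E.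
Proof.
move=> lpt gy e0; have := thin_avg (measurable_col_gap c d) (col_gap_bound c d) lpt gy e0.
apply: filterS => r; apply: le_trans.
have mb : measurable (ball x r : set R) by exact: measurable_ball.
rewrite lebesgue2_xsections; last first.
  by apply: measurableI; [exact: measurableC|exact: measurableX].
rewrite [leRHS]integral_mkcond le_eqVlt; apply/orP; left; apply/eqP.
apply: eq_integral => t _; rewrite patchE; case: ifPn => [|] tb.
  rewrite col_gapE; congr (mu _); apply/seteqP; split => y.
    by move=> /xsectionP[/= nS [_ xab]]; split => // /xsectionP.
  move=> [nS xab]; apply/xsectionP; split; first by move=> Sx; apply: nS; apply/xsectionP.
  by split => //=; rewrite inE in tb.
rewrite (_ : xsection _ _ = set0) ?measure0// -subset0 => y /xsectionP[_ [/= tb' _]].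
by move: tb; rewrite notin_setE.
Qed.

(** Measure the part of [S] in [E] times [F] in two ways: by columns it is null, by rows it is the
    product of the measures of [E] and [F]. *)
Lemma full_rows_empty_cols (F E : set R) (a b c d : R) : measurable F -> measurable E ->
  F `<=` `]c, d[ -> E `<=` `]a, b[ ->
  (forall y, F y -> mu (~` ysection S y `&` `]a, b[) = 0%E) ->
  (forall x, E x -> mu (xsection S x `&` `]c, d[) = 0%E) ->
  (0 < mu F)%E -> mu E = 0%E.
Proof.
move=> mF mE Fcd Eab F0 E0 Fpos.
have mFE : measurable (S `&` (E `*` F)) by apply: measurableI => //; exact: measurableX.
have := lebesgue2_ysections mFE; rewrite lebesgue2_xsections//.
rewrite integral0_eq; last first.
  move=> x _; have [Ex|nEx] := pselect (E x); last first.
    by rewrite (_ : xsection _ _ = set0) ?measure0// -subset0 => y /xsectionP[_ [/= ]].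
  apply/eqP; rewrite -measure_le0 -(E0 _ Ex); apply: le_measure; rewrite ?inE//.
  - exact: measurable_xsection.
  - by apply: measurableI; [exact: measurable_xsection_R|exact: measurable_itv].
  - move=> y /xsectionP[Sxy [_ Fy]]; split; [exact/xsectionP|exact: Fcd].
have -> : (\int[mu]_y mu (ysection (S `&` E `*` F) y) = \int[mu]_(y in F) cst (mu E) y)%E.
  rewrite [RHS]integral_mkcond; apply: eq_integral => y _; rewrite patchE.
  case: ifPn => [|] yF; last first.
    rewrite (_ : ysection _ _ = set0) ?measure0// -subset0 => x /ysectionP[_ [_ /=]].
    by move: yF; rewrite notin_setE.
  rewrite inE in yF; apply/eqP; rewrite eq_le; apply/andP; split.
    apply: le_measure; rewrite ?inE//; first exact: measurable_ysection.
    by move=> x /ysectionP[_ []].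
  rewrite -[leRHS]adde0 -(F0 _ yF).
  have m1 : measurable (ysection (S `&` E `*` F) y : set R) by exact: measurable_ysection.
  have m2 : measurable (~` ysection S y `&` `]a, b[ : set R).
    by apply: measurableI; [apply: measurableC; exact: measurable_ysection_R|exact: measurable_itv].
  apply: le_trans (measureU2 mu m1 m2).
  apply: le_measure; rewrite ?inE//; first exact: measurableU.
  move=> x Ex; have [Sxy|nS] := pselect (S (x, y)).
    by left; apply/ysectionP.
  by right; split; [move=> /ysectionP|exact: Eab].
rewrite integral_cst// => /esym/eqP; rewrite mule_eq0 => /orP[/eqP//|/eqP F00].
by rewrite F00 ltxx in Fpos.
Qed.

End sections.

(** * The estimate on one square *)

Section square.
Context {R : realType}.
Notation mu := (@lebesgue_measure R).
Notation rT := (measurableTypeR R).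
Notation L2 := (@lebesgue2 R).

Lemma itv_measure (x y : R) : x <= y -> mu `]x, y[%classic = (y - x)%:E.
Proof.
move=> xy; rewrite lebesgue_measure_itv/= lte_fin; case: ltP => yx; rewrite -?EFinB//.
by rewrite (_ : y - x = 0)//; lra.
Qed.

Lemma lebesgue2X (A B : set R) : measurable A -> measurable B ->
  L2 (A `*` B) = (mu A * mu B)%E.
Proof.
move=> mA mB; rewrite lebesgue2E; last exact: measurableX.
exact: (@product_measure1E _ _ rT rT R mu mu A B mA mB).
Qed.

(** The points where [g] is positive have measure at most [w], and almost every point is a Lebesgue
    point, so together the unsuitable points cannot fill an interval longer than [w]. *)
Lemma pick_line (g : R -> R) (K x y w : R) : measurable_fun setT g ->
  (forall t, 0 <= g t <= K) -> x < y -> w < y - x ->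
  (mu [set t | (x < t < y)%R /\ (0 < g t)%R] <= w%:E)%E ->
  exists t, [/\ x < t < y, g t = 0 & lebesgue_pt g t].
Proof.
move=> mg gK xy wxy le_w.
have gK' t : `|g t| <= K by have /andP[g0 ?] := gK t; rewrite ger0_norm.
have [Z [mZ Z0 hZ]] := gap_lebesgue_pt mg gK'.
apply: contrapT => nex.
have mP : measurable [set t | (x < t < y)%R /\ (0 < g t)%R].
  rewrite (_ : [set t | _] = `]x, y[%classic `&` g @^-1` `]0, +oo[%classic).
    apply: measurableI => //; rewrite -[X in measurable X]setTI; exact: mg.
  by apply/seteqP; split => t /=; rewrite !in_itv/= andbT.
have : (mu `]x, y[%classic <= w%:E)%E.
  apply: (@le_trans _ _ (mu ([set t | (x < t < y)%R /\ (0 < g t)%R] `|` Z))).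
    apply: le_measure; rewrite ?inE//; first exact: measurableU.
    move=> t; rewrite /= in_itv/= => xty.
    have [g0|g0] := ltP 0 (g t); first by left.
    right; apply: hZ => lpt; apply: nex; exists t; split => //.
    by apply/eqP; rewrite eq_le g0; have /andP[] := gK t.
  by apply: le_trans (measureU2 mu mP mZ) _; rewrite /= Z0 adde0.
by rewrite itv_measure ?lee_fin; lra.
Qed.

Lemma frame_sub (a b c d a' b' c' d' r : R) : 0 < r -> a' + r <= b' - r -> c' + r <= d' - r ->
  r <= a' - a -> r <= b - b' -> r <= c' - c -> r <= d - d' ->
  frame a' b' c' d' r `<=` (ball a' r `*` `]c, d[ `|` ball b' r `*` `]c, d[) `|`
    (`]a, b[ `*` ball c' r `|` `]a, b[ `*` ball d' r).
Proof.
move=> r0 ab cd ra rb rc rd x [[]]; rewrite /= !in_itv/= => /andP[x1 x2] /andP[x3 x4] nin.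
have xab : `]a, b[%classic x.1 by rewrite /= in_itv/=; apply/andP; split; lra.
have xcd : `]c, d[%classic x.2 by rewrite /= in_itv/=; apply/andP; split; lra.
have [xa|xa] := ltP x.1 (a' + r).
  by left; left; split => //; apply/mem_ball; rewrite x1.
have [xb|xb] := ltP (b' - r) x.1.
  by left; right; split => //; apply/mem_ball; rewrite xb.
have [xc|xc] := ltP x.2 (c' + r).
  by right; left; split => //; apply/mem_ball; rewrite x3.
right; right; split => //; apply/mem_ball; rewrite x4 andbT ltNge; apply/negP => xd; apply: nin.
by rewrite /cbox/= !in_itv/= xa xb xc xd.
Qed.

Variables (S : set (R * R)) (M : R).
Hypothesis mS : measurable S.
Hypothesis SM : forall phi, test_field phi -> flux S phi <= M.

(** Zero trace of the complement of [S] on the boundary of the rectangle, in the form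
    [perimeter_cut] uses: arbitrarily small radii along which the measure in the frame is $o(r)$. *)
Definition thin_frame a b c d := forall e : R, 0 < e -> exists r : R,
  [/\ 0 < r < e, a + r <= b - r, c + r <= d - r &
     (L2 (~` S `&` frame a b c d r) <= (e * r)%:E)%E].

Lemma thin_frame_lebesgue_pt a b c d a' b' c' d' :
  a < a' -> a' < b' -> b' < b -> c < c' -> c' < d' -> d' < d ->
  lebesgue_pt (col_gap S c d) a' -> col_gap S c d a' = 0 ->
  lebesgue_pt (col_gap S c d) b' -> col_gap S c d b' = 0 ->
  lebesgue_pt (row_gap S a b) c' -> row_gap S a b c' = 0 ->
  lebesgue_pt (row_gap S a b) d' -> row_gap S a b d' = 0 ->
  thin_frame a' b' c' d'.
Proof.
move=> aa ab bb cc cd dd la a0 lb b0 lc c0 ld d0 e e0.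
(* A quarter of the error for each side of the rectangle. *)
have e4 : 0 < e / 4 by lra.
have ta := thin_col mS la a0 e4; have tb := thin_col mS lb b0 e4.
have tc := thin_row mS lc c0 e4; have td := thin_row mS ld d0 e4.
near (0 : R)^'+ => r.
have aux (x y : R) : r <= (y - x) / 2 -> x + r <= y - r by lra.
have r0 : 0 < r by [].
have re : r < e by near: r; exact: nbhs_right_lt.
have r1 : r <= (b' - a') / 2 by near: r; apply: nbhs_right_le; lra.
have r2 : r <= (d' - c') / 2 by near: r; apply: nbhs_right_le; lra.
have r3 : r <= a' - a by near: r; apply: nbhs_right_le; lra.
have r4 : r <= b - b' by near: r; apply: nbhs_right_le; lra.
have r5 : r <= c' - c by near: r; apply: nbhs_right_le; lra.
have r6 : r <= d - d' by near: r; apply: nbhs_right_le; lra.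
have ha : (L2 (~` S `&` (ball a' r `*` `]c, d[)) <= (e / 4 * r)%:E)%E by near: r; apply: ta.
have hb : (L2 (~` S `&` (ball b' r `*` `]c, d[)) <= (e / 4 * r)%:E)%E by near: r; apply: tb.
have hc : (L2 (~` S `&` (`]a, b[ `*` ball c' r)) <= (e / 4 * r)%:E)%E by near: r; apply: tc.
have hd : (L2 (~` S `&` (`]a, b[ `*` ball d' r)) <= (e / 4 * r)%:E)%E by near: r; apply: td.
have r1' : a' + r <= b' - r by move: r1; exact: aux.
have r2' : c' + r <= d' - r by move: r2; exact: aux.
exists r; split; [by rewrite r0|exact: r1'|exact: r2'|].
apply: (@le_trans _ _ (L2 ((~` S `&` (ball a' r `*` `]c, d[) `|` ~` S `&` (ball b' r `*` `]c, d[)) `|`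
   (~` S `&` (`]a, b[ `*` ball c' r) `|` ~` S `&` (`]a, b[ `*` ball d' r))))).
  apply: le_lebesgue2 => x [nS /(frame_sub r0 r1' r2' r3 r4 r5 r6)].
  by move=> [[h|h]|[h|h]]; [left; left|left; right|right; left|right; right].
apply: le_trans (lebesgue2U _ _) _.
have -> : (e * r)%:E = ((e / 4 * r)%:E + (e / 4 * r)%:E + ((e / 4 * r)%:E + (e / 4 * r)%:E))%E.
  by rewrite -!EFinD; congr EFin; field.
by apply: leeD; apply: le_trans (lebesgue2U _ _) _; apply: leeD.
Unshelve. all: by end_near. Qed.

Section one_square.
Variables (a b c d delta : R).
Hypotheses (delta0 : 0 < delta) (abE : b = a + delta) (cdE : d = c + delta).
Let p := local_perimeter S (box a b c d).

Let impure_row_set := [set y | [/\ (c < y < d)%R, (0 < mu (ysection S y `&` `]a, b[))%E &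
                (0 < mu (~` ysection S y `&` `]a, b[))%E]].
(** Nullity is written [<= 0], the complementary case of [0 <] in [ltP], so that every line of the
    square falls into one of three classes by case analysis. *)
Let full_row_set := [set y | (c < y < d)%R /\ (mu (~` ysection S y `&` `]a, b[) <= 0)%E].
Let empty_row_set := [set y | (c < y < d)%R /\ (mu (ysection S y `&` `]a, b[) <= 0)%E].
Let impure_col_set := [set x | [/\ (a < x < b)%R, (0 < mu (xsection S x `&` `]c, d[))%E &
                (0 < mu (~` xsection S x `&` `]c, d[))%E]].
Let full_col_set := [set x | (a < x < b)%R /\ (mu (~` xsection S x `&` `]c, d[) <= 0)%E].
Let empty_col_set := [set x | (a < x < b)%R /\ (mu (xsection S x `&` `]c, d[) <= 0)%E].

Let mfr : measurable_fun setT (fun y => mu (ysection S y `&` `]a, b[)).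
Proof. exact: (measurable_ysection_measure mS (measurable_itv _)). Qed.
Let mgr : measurable_fun setT (fun y => mu (~` ysection S y `&` `]a, b[)).
Proof.
rewrite (_ : (fun y => mu _) = EFin \o row_gap S a b); first by apply/measurable_EFinP; exact: measurable_row_gap.
by apply/funext => y; rewrite /= row_gapE.
Qed.
Let mfc : measurable_fun setT (fun x => mu (xsection S x `&` `]c, d[)).
Proof. exact: (measurable_xsection_measure mS (measurable_itv _)). Qed.
Let mgc : measurable_fun setT (fun x => mu (~` xsection S x `&` `]c, d[)).
Proof.
rewrite (_ : (fun y => mu _) = EFin \o col_gap S c d); first by apply/measurable_EFinP; exact: measurable_col_gap.
by apply/funext => y; rewrite /= col_gapE.
Qed.

Let m_le0 (x y : R) (f : R -> \bar R) : measurable_fun setT f ->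
  measurable [set t | (x < t < y)%R /\ (f t <= 0)%E].
Proof.
move=> mf; rewrite (_ : [set t | _] = `]x, y[%classic `&` (setT `&` [set t | (f t <= 0)%E])).
  by apply: measurableI => //; exact: emeasurable_fun_infty_c.
by apply/seteqP; split => t /=; rewrite in_itv/=; tauto.
Qed.

Let m_gt0 (x y : R) (f g : R -> \bar R) : measurable_fun setT f -> measurable_fun setT g ->
  measurable [set t | [/\ (x < t < y)%R, (0 < f t)%E & (0 < g t)%E]].
Proof.
move=> mf mg; rewrite (_ : [set t | _] = `]x, y[%classic `&`
   ((setT `&` [set t | (0 < f t)%E]) `&` (setT `&` [set t | (0 < g t)%E]))).
  by apply: measurableI => //; apply: measurableI; exact: emeasurable_fun_o_infty.
apply/seteqP; split => t /=; rewrite in_itv/=; first by move=> [].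
by move=> [h1 [[_ h2] [_ h3]]]; split.
Qed.

Let row_cases y : (c < y < d)%R -> [\/ impure_row_set y, full_row_set y | empty_row_set y].
Proof.
move=> cyd; have [g0|g0] := ltP 0%E (mu (~` ysection S y `&` `]a, b[)); last by constructor 2.
have [f0|f0] := ltP 0%E (mu (ysection S y `&` `]a, b[)); last by constructor 3.
by constructor 1.
Qed.

Let p0 : 0 <= p. Proof. exact: (local_perimeter_ge0 SM). Qed.

Lemma no_full_rows : mu full_row_set = 0%E ->
  (L2 (box a b c d `&` S) <= (15 * delta * p)%:E)%E.
Proof.
move=> F0.
have mN : measurable impure_row_set by exact: m_gt0.
have mF : measurable full_row_set by exact: m_le0.
have mE : measurable empty_row_set by exact: m_le0.
have mI : measurable (`]a, b[%classic : set R) by exact: measurable_itv.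
have muI : mu `]a, b[%classic = delta%:E.
  rewrite itv_measure; last by move: delta0 abE => ? ->; lra.
  by congr EFin; move: abE => ->; ring.
have hN : L2 (`]a, b[ `*` impure_row_set) = (delta%:E * mu impure_row_set)%E.
  by rewrite lebesgue2X// muI.
have hF : L2 (`]a, b[ `*` full_row_set) = 0%E.
  by rewrite lebesgue2X// F0 mule0.
have hE : L2 (S `&` (`]a, b[ `*` empty_row_set)) = 0%E.
  rewrite lebesgue2_ysections; last by apply: measurableI => //; exact: measurableX.
  rewrite integral0_eq// => y _; have [Ey|nEy] := pselect (empty_row_set y); last first.
    by rewrite (_ : ysection _ _ = set0) ?measure0// -subset0 => x /ysectionP[_ []].
  apply/eqP; rewrite -measure_le0; apply: le_trans Ey.2; apply: le_measure; rewrite ?inE//.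
  - apply: measurable_ysection; apply: measurableI => //; exact: measurableX.
  - by apply: measurableI => //; exact: measurable_ysection_R.
  - by move=> x /ysectionP[Sx [xI _]]; split => //; apply/ysectionP.
apply: (@le_trans _ _ (L2 ((`]a, b[ `*` impure_row_set `|` `]a, b[ `*` full_row_set) `|`
    S `&` (`]a, b[ `*` empty_row_set)))).
  apply: le_lebesgue2 => x [[x1 x2] Sx]; move: x2; rewrite /= in_itv/= => /row_cases[h|h|h].
  - by left; left; split.
  - by left; right; split.
  - by right; split => //; split.
apply: le_trans (lebesgue2U _ _) _; rewrite hE adde0.
apply: le_trans (lebesgue2U _ _) _; rewrite hF adde0 hN.
apply: (@le_trans _ _ (delta%:E * (15 * p)%:E)%E).
  by apply: lee_wpmul2l; [rewrite lee_fin; exact: ltW|exact: (impure_rows mS SM)].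
by rewrite -EFinM lee_fin; rewrite le_eqVlt; apply/orP; left; apply/eqP; ring.
Qed.

Let col_cases x : (a < x < b)%R -> [\/ impure_col_set x, full_col_set x | empty_col_set x].
Proof.
move=> cyd; have [g0|g0] := ltP 0%E (mu (~` xsection S x `&` `]c, d[)); last by constructor 2.
have [f0|f0] := ltP 0%E (mu (xsection S x `&` `]c, d[)); last by constructor 3.
by constructor 1.
Qed.

(** Full rows of positive measure exclude empty columns. Were there also empty rows of positive
    measure, full columns would be excluded in the same way; then almost all columns would be
    impure, although their measure is at most [15 * p < delta]. *)
Lemma full_row_no_empty : 15 * p < delta -> mu full_row_set != 0%E ->
  mu empty_row_set = 0%E /\ mu empty_col_set = 0%E.
Proof.
move=> pd F0.
have mF1 : measurable full_row_set by exact: m_le0.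
have mE1 : measurable empty_row_set by exact: m_le0.
have mN2 : measurable impure_col_set by exact: m_gt0.
have mF2 : measurable full_col_set by exact: m_le0.
have mE2 : measurable empty_col_set by exact: m_le0.
have E20 : mu empty_col_set = 0%E.
  apply: (full_rows_empty_cols mS mF1 mE2 (a := a) (b := b) (c := c) (d := d)).
  - by move=> y [cyd _]; rewrite /= in_itv.
  - by move=> x [axb _]; rewrite /= in_itv.
  - by move=> y [_ h]; apply/eqP; rewrite -measure_le0.
  - by move=> x [_ h]; apply/eqP; rewrite -measure_le0.
  - by rewrite lt0e F0 measure_ge0.
split => //; apply/eqP; apply: contraT => E10.
suff F20 : mu full_col_set = 0%E.
  have : (mu `]a, b[%classic <= (15 * p)%:E)%E.
    apply: (@le_trans _ _ (mu ((impure_col_set `|` full_col_set) `|` empty_col_set))).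
      apply: le_measure; rewrite ?inE//; first by apply: measurableU => //; exact: measurableU.
      by move=> x; rewrite /= in_itv/= => /col_cases[h|h|h]; [left; left|left; right|right].
    apply: le_trans (measureU2 mu (measurableU _ _ mN2 mF2) mE2) _; rewrite /= E20 adde0.
    apply: le_trans (measureU2 mu mN2 mF2) _; rewrite /= F20 adde0.
    exact: (impure_cols mS SM).
  have ab : a <= b by rewrite abE; move: delta0; lra.
  rewrite itv_measure// lee_fin abE (_ : a + delta - a = delta); last by ring.
  by rewrite leNgt pd.
(* Passing to the complement of [S] exchanges full and empty lines. *)
apply: (full_rows_empty_cols (measurableC mS) mE1 mF2 (a := a) (b := b) (c := c) (d := d)).
- by move=> y [cyd _]; rewrite /= in_itv.
- by move=> x [axb _]; rewrite /= in_itv.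
- by move=> y [_ h]; apply/eqP; rewrite -measure_le0 ysectionC setCK.
- by move=> x [_ h]; apply/eqP; rewrite -measure_le0 xsectionC.
- by rewrite lt0e E10 measure_ge0.
Qed.

Variable U : set (R * R).
Hypothesis UP : forall a' b' c' d', a' < b' -> c' < d' -> thin_frame a' b' c' d' ->
  box a' b' c' d' `<=` U.

(** As rows and columns that are not full have measure at most [15 * p < w], each of the four
    margins of width [w] contains a generic full line. These lines bound a rectangle contained in
    [U], and what is left of the square lies in the margins, each of area [w * delta]. *)
Lemma full_row_case (w : R) : 15 * p < w -> 2 * w < delta ->
  mu full_row_set != 0%E -> (L2 (box a b c d `\` U) <= (4 * w * delta)%:E)%E.
Proof.
move=> pw wd F0.
have w0 : 0 < w by apply: le_lt_trans pw; rewrite mulr_ge0.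
have dd := delta0; have e1 := abE; have e2 := cdE.
have pd : 15 * p < delta by lra.
have [E10 E20] := full_row_no_empty pd F0.
have mE1 : measurable empty_row_set by exact: m_le0.
have mE2 : measurable empty_col_set by exact: m_le0.
have mN1 : measurable impure_row_set by exact: m_gt0.
have mN2 : measurable impure_col_set by exact: m_gt0.
have mpos (g : R -> R) x y : measurable_fun setT g ->
    measurable [set t | (x < t < y)%R /\ (0 < g t)%R].
  move=> mg; rewrite (_ : [set t | _] = `]x, y[%classic `&` g @^-1` `]0, +oo[%classic).
    by apply: measurableI => //; rewrite -[X in measurable X]setTI; exact: mg.
  by apply/seteqP; split => t /=; rewrite !in_itv/= andbT.
have row_le x y : c <= x -> y <= d ->
    (mu [set t | (x < t < y)%R /\ (0 < row_gap S a b t)%R] <= (15 * p)%:E)%E.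
  move=> cx yd; apply: (@le_trans _ _ (mu (impure_row_set `|` empty_row_set))); last first.
    apply: le_trans (measureU2 mu mN1 mE1) _; rewrite /= E10 adde0.
    exact: (impure_rows mS SM).
  have mA : measurable [set t | (x < t < y)%R /\ (0 < row_gap S a b t)%R].
    exact: (mpos _ _ _ (measurable_row_gap mS _ _)).
  have mB : measurable (impure_row_set `|` empty_row_set) by exact: measurableU.
  apply: le_measure; rewrite ?inE; [exact: mA|exact: mB|].
  move=> t [/andP[xt ty] gt0]; have ctd : c < t < d by apply/andP; split; lra.
  have [h|h|h] := row_cases ctd; [by left| |by right].
  by case: h => _; rewrite -row_gapE// lee_fin leNgt gt0.
have col_le x y : a <= x -> y <= b ->
    (mu [set t | (x < t < y)%R /\ (0 < col_gap S c d t)%R] <= (15 * p)%:E)%E.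
  move=> cx yd; apply: (@le_trans _ _ (mu (impure_col_set `|` empty_col_set))); last first.
    apply: le_trans (measureU2 mu mN2 mE2) _; rewrite /= E20 adde0.
    exact: (impure_cols mS SM).
  have mA : measurable [set t | (x < t < y)%R /\ (0 < col_gap S c d t)%R].
    exact: (mpos _ _ _ (measurable_col_gap mS _ _)).
  have mB : measurable (impure_col_set `|` empty_col_set) by exact: measurableU.
  apply: le_measure; rewrite ?inE; [exact: mA|exact: mB|].
  move=> t [/andP[xt ty] gt0]; have ctd : a < t < b by apply/andP; split; lra.
  have [h|h|h] := col_cases ctd; [by left| |by right].
  by case: h => _; rewrite -col_gapE// lee_fin leNgt gt0.
have rg := measurable_row_gap mS a b; have cg := measurable_col_gap mS c d.
have rb := row_gap_bound mS a b; have cb := col_gap_bound mS c d.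
have [|||c' [/andP[c1 c2] c0 lc]] := @pick_line _ _ c (c + w) (15 * p) rg rb; [lra|lra|apply: row_le; lra|].
have [|||d' [/andP[d1 d2] d0 ld]] := @pick_line _ _ (d - w) d (15 * p) rg rb; [lra|lra|apply: row_le; lra|].
have [|||a' [/andP[a1 a2] a0 la]] := @pick_line _ _ a (a + w) (15 * p) cg cb; [lra|lra|apply: col_le; lra|].
have [|||b' [/andP[b1 b2] b0 lb]] := @pick_line _ _ (b - w) b (15 * p) cg cb; [lra|lra|apply: col_le; lra|].
have ab' : a' < b' by lra.
have cd' : c' < d' by lra.
have RU : box a' b' c' d' `<=` U.
  by apply: UP => //; apply: (@thin_frame_lebesgue_pt a b c d).
have boxE x y z t : x <= y -> z <= t -> L2 (box x y z t) = ((y - x) * (t - z))%:E.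
  by move=> xy zt; rewrite lebesgue2_box.
apply: (@le_trans _ _ (L2 ((box a (a + w) c d `|` box (b - w) b c d) `|`
    (box a b c (c + w) `|` box a b (d - w) d)))).
  apply: le_lebesgue2 => x [[]]; rewrite /= !in_itv/= => /andP[x1 x2] /andP[x3 x4] nU.
  have [h1|h1] := ltP x.1 (a + w).
    by left; left; split; rewrite /= in_itv/=; apply/andP.
  have [h2|h2] := ltP (b - w) x.1.
    by left; right; split; rewrite /= in_itv/=; apply/andP.
  have [h3|h3] := ltP x.2 (c + w).
    by right; left; split; rewrite /= in_itv/=; apply/andP.
  have [h4|h4] := ltP (d - w) x.2.
    by right; right; split; rewrite /= in_itv/=; apply/andP.
  exfalso; apply: nU; apply: RU; split; rewrite /= in_itv/=; apply/andP; split; lra.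
apply: le_trans (lebesgue2U _ _) _.
apply: (@le_trans _ _ (((w * delta)%:E + (w * delta)%:E) + ((w * delta)%:E + (w * delta)%:E))%E).
  apply: leeD; apply: le_trans (lebesgue2U _ _) _; apply: leeD.
  - by rewrite boxE; [rewrite lee_fin; nra|lra|lra].
  - by rewrite boxE; [rewrite lee_fin; nra|lra|lra].
  - by rewrite boxE; [rewrite lee_fin; nra|lra|lra].
  - by rewrite boxE; [rewrite lee_fin; nra|lra|lra].
by rewrite -!EFinD lee_fin; lra.
Qed.

Lemma square_bound : (L2 (box a b c d `&` S `\` U) <= (60 * delta * p)%:E)%E.
Proof.
have [F0|F0] := eqVneq (mu full_row_set) 0%E.
  apply: (@le_trans _ _ (L2 (box a b c d `&` S))); first by apply: le_lebesgue2 => x [].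
  apply: le_trans (no_full_rows F0) _; rewrite lee_fin.
  by rewrite ler_wpM2r// ler_wpM2r//; [exact: ltW|lra].
have sub : box a b c d `&` S `\` U `<=` box a b c d `\` U by move=> x [[]].
(* If [delta <= 60 * p], the area of the whole square already satisfies the bound. *)
have [pd|pd] := leP (delta / 4) (15 * p).
  apply: (@le_trans _ _ (L2 (box a b c d))); first by apply: le_lebesgue2 => x [[]].
  have dd := delta0; have e1 := abE; have e2 := cdE.
  by rewrite lebesgue2_box; [rewrite lee_fin; nra|lra|lra].
apply/lee_addgt0Pr => e e0; apply: (le_trans (le_lebesgue2 sub)).
have dd := delta0.
(* The margin must exceed [15 * p] strictly; an excess of [e / (4 * delta)] adds only [e] to the
   area of the four margins. The cap [delta / 3], itself above [15 * p] here, keeps opposite margins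
   apart. *)
pose w := Num.min (15 * p + e / (4 * delta)) (delta / 3).
have ed0 : 0 < e / (4 * delta) by rewrite divr_gt0// mulr_gt0.
have w1 : 15 * p < w by rewrite /w lt_min; apply/andP; split; lra.
have w2 : 2 * w < delta.
  have : w <= delta / 3 by rewrite /w ge_min lexx orbT.
  by lra.
have w3 : w <= 15 * p + e / (4 * delta) by rewrite /w ge_min lexx.
apply: le_trans (full_row_case w1 w2 F0) _; rewrite -EFinD lee_fin.
have : w * (4 * delta) <= (15 * p + e / (4 * delta)) * (4 * delta).
  by rewrite ler_wpM2r// mulr_ge0// ltW.
have -> : (15 * p + e / (4 * delta)) * (4 * delta) = 60 * delta * p + e.
  by field; rewrite gt_eqF.
by lra.
Qed.

End one_square.
End square.

(** * Conclusion *)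

Section subdivision.
Context {R : realType}.
Notation L2 := (@lebesgue2 R).

Lemma lebesgue2_vline (t : R) : L2 ([set t] `*` setT) = 0%E.
Proof. by rewrite lebesgue2X// lebesgue_measure_set1 mul0e. Qed.

Lemma lebesgue2_hline (t : R) : L2 (setT `*` [set t]) = 0%E.
Proof. by rewrite lebesgue2X// lebesgue_measure_set1 mule0. Qed.

Variables (S U : set (R * R)) (M : R).
Hypothesis mS : measurable S.
Hypothesis SM : forall phi, test_field phi -> flux S phi <= M.
Hypothesis UP : forall a b c d, a < b -> c < d -> thin_frame S a b c d ->
  box a b c d `<=` U.

(** Each step cuts the square into four quarters of half the side, up to two null median lines. The
    local perimeters of the quarters sum to at most that of the square, so only the factor [delta]
    changes, and it is halved. *)
Lemma square_bound_dyadic (k : nat) (a c delta : R) : 0 < delta ->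
  (L2 (box a (a + delta) c (c + delta) `&` S `\` U) <=
   (60 * (delta / 2 ^+ k) * local_perimeter S (box a (a + delta) c (c + delta)))%:E)%E.
Proof.
have mS2 := lebesgue2_measurable_borel mS.
elim: k a c delta => [|k IHk] a c delta delta0.
  by rewrite expr0 divr1; exact: (square_bound mS SM).
pose h := delta / 2; have h0 : 0 < h by rewrite /h; lra.
have hh : delta = h + h by rewrite /h; lra.
have kE : h / 2 ^+ k = delta / 2 ^+ k.+1 by rewrite /h exprS invfM mulrA.
pose W := S `\` U; pose p (Q : set (R * R)) := local_perimeter S Q.
pose Q1 := box a (a + h) c (c + h); pose Q2 := box (a + h) (a + h + h) c (c + h).
pose Q3 := box a (a + h) (c + h) (c + h + h).
pose Q4 := box (a + h) (a + h + h) (c + h) (c + h + h).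
set Q := box a (a + delta) c (c + delta).
have ps : p Q1 + p Q2 + (p Q3 + p Q4) <= p Q.
  have d12 : Q1 `&` Q2 = set0.
    by rewrite -subset0 => x [[/= + _] [/= + _]]; rewrite !in_itv/=; lra.
  have d34 : Q3 `&` Q4 = set0.
    by rewrite -subset0 => x [[/= + _] [/= + _]]; rewrite !in_itv/=; lra.
  have d1234 : (Q1 `|` Q2) `&` (Q3 `|` Q4) = set0.
    by rewrite -subset0 => x [h1 h2]; move: h1 h2;
      case=> h1; case=> h2; case: h1 => _ /=; case: h2 => _ /=; rewrite !in_itv/=; lra.
  apply: le_trans (lerD (local_perimeterD mS2 SM d12) (local_perimeterD mS2 SM d34)) _.
  apply: le_trans (local_perimeterD mS2 SM d1234) _.
  apply: (local_perimeterS SM) => x; rewrite /Q hh.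
  by case=> h1; case: h1 => h1; case: h1 => /=; rewrite !in_itv/= => x1 x2;
    split; rewrite /= in_itv/=; lra.
apply: (@le_trans _ _ (L2 ((((Q1 `&` S `\` U) `|` (Q2 `&` S `\` U)) `|`
   ((Q3 `&` S `\` U) `|` (Q4 `&` S `\` U))) `|`
   (([set a + h] `*` setT) `|` (setT `*` [set c + h]))))).
  apply: le_lebesgue2 => x [[[/=]]]; rewrite /= !in_itv/= hh => /andP[x1 x2] /andP[x3 x4] Sx nUx.
  have mk (P : set (R * R)) : P x -> (P `&` S `\` U) x by move=> ?; split.
  have x2' : x.1 < a + h + h by lra.
  have x4' : x.2 < c + h + h by lra.
  case: (ltgtP x.1 (a + h)) => l1; last by right; left.
    case: (ltgtP x.2 (c + h)) => l2; last by right; right.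
      by left; left; left; apply: mk; split; rewrite /= in_itv/= ?x1 ?x3.
    by left; right; left; apply: mk; split; rewrite /= in_itv/= ?x1 ?l2.
  case: (ltgtP x.2 (c + h)) => l2; last by right; right.
    by left; left; right; apply: mk; split; rewrite /= in_itv/= ?l1 ?x3.
  by left; right; right; apply: mk; split; rewrite /= in_itv/= ?l1 ?l2.
apply: le_trans (lebesgue2U _ _) _.
rewrite (lebesgue2_nullU (lebesgue2_vline _) (lebesgue2_hline _)) adde0.
apply: le_trans (lebesgue2U _ _) _.
apply: (le_trans (leeD (lebesgue2U _ _) (lebesgue2U _ _))).
apply: (le_trans (leeD (leeD (IHk _ _ _ h0) (IHk _ _ _ h0)) (leeD (IHk _ _ _ h0) (IHk _ _ _ h0)))).
rewrite kE -!EFinD lee_fin -!mulrDr ler_wpM2l//.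
by rewrite mulr_ge0// divr_ge0 ?exprn_ge0// ltW.
Qed.

Lemma square_null (a c delta : R) : 0 < delta ->
  L2 (box a (a + delta) c (c + delta) `&` S `\` U) = 0%E.
Proof.
move=> delta0; apply/eqP; rewrite eq_le lebesgue2_ge0 andbT.
apply/lee_addgt0Pr => e e0; rewrite add0e.
have p0 := local_perimeter_ge0 SM (box a (a + delta) c (c + delta)).
pose K := 60 * delta * local_perimeter S (box a (a + delta) c (c + delta)).
have K0 : 0 <= K by rewrite /K !mulr_ge0// ltW.
near \oo => k.
apply: le_trans (square_bound_dyadic k a c delta0) _; rewrite lee_fin.
rewrite (_ : 60 * _ * _ = K / 2 ^+ k); last by rewrite /K; ring.
rewrite ler_pdivrMr ?exprn_gt0// -ler_pdivrMl//.
apply: (@le_trans _ _ k%:R); last first.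
  by rewrite -natrX ler_nat ltnW// ltn_expl.
by near: k; exact: nbhs_infty_ger.
Unshelve. all: by end_near. Qed.

Lemma open_hull_null : L2 (S `\` U) = 0%E.
Proof.
(* The side is [2 n + 1] and not [2 n], to be positive for [n = 0] as [square_null] requires. *)
apply: (@lebesgue2_null_sub _ _ (\bigcup_n
   (box (- n%:R) (- n%:R + (n + n).+1%:R) (- n%:R) (- n%:R + (n + n).+1%:R) `&` S `\` U))).
  move=> x [Sx nUx]; near \oo => n.
  have h1 : `|x.1| < n%:R by near: n; exact: nbhs_infty_gtr.
  have h2 : `|x.2| < n%:R by near: n; exact: nbhs_infty_gtr.
  exists n => //; split => //; split => //.
  move: h1 h2; rewrite !ltr_norml => /andP[x1 x2] /andP[x3 x4].
  have nE : (n + n).+1%:R = n%:R + n%:R + 1 :> R by rewrite -natr1 natrD.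
  by split; rewrite /= in_itv/= nE; apply/andP; split; lra.
apply: lebesgue2_null_bigcup => [|n _]; first exact: countableP.
exact: square_null.
Unshelve. all: by end_near. Qed.

End subdivision.

(** * Infinite components, null boxes and the open representative *)

Section conclusion.
Context {R : realType}.
Notation mu := (@lebesgue_measure R).
Notation L2 := (@lebesgue2 R).
Notation ct := (caratheodory_type ((mu \x mu)%E^*)%mu).

Lemma BVnorm_null (S U : set (R * R)) : lebesgue2_measurable S -> lebesgue2_measurable U ->
  L2 (S `+` U) = 0%E -> BVnorm (\1_S \- \1_U) = 0%E.
Proof.
move=> mS mU SU; pose f : R * R -> R := \1_S \- \1_U.
have mf : measurable_fun [set: ct] (f : ct -> R).
  by apply: measurable_funB; exact: measurable_indic.
have f0 x : ~ (S `+` U) x -> f x = 0.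
  rewrite setY_def /f/= !indicE => nx; case: (boolP (x \in S)); case: (boolP (x \in U)).
  - by rewrite subrr.
  - by rewrite inE notin_setE => nU Sx; exfalso; apply: nx; left.
  - by rewrite inE notin_setE => Ux nS; exfalso; apply: nx; right.
  - by rewrite subrr.
have null (g : R * R -> \bar R) : measurable_fun [set: ct] (g : ct -> \bar R) ->
    (forall x, ~ (S `+` U) x -> g x = 0%E) -> (\int[L2]_x g x = 0)%E.
  move=> mg g0; apply: (@eq_trans _ _ (\int[L2]_(x in setT) cst 0%E x)%E); last first.
    by rewrite integral0.
  apply: (@ae_eq_integral _ ct R L2) => //.
  exists (S `+` U); split => //; first exact: (lebesgue2_null_measurable SU).
  by move=> x /= h; apply: contrapT => nx; apply: h => _; exact: g0.
have mnf : measurable_fun [set: ct] (EFin \o (fun x : ct => `|f x|)).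
  exact: ((measurable_EFinP _ _).2 (measurableT_comp (@normr_measurable R setT) mf)).
rewrite /BVnorm Lnorm1 (null _ mnf); last by move=> x /f0 fx; rewrite /= fx normr0.
rewrite add0e; apply/eqP; rewrite eq_le; apply/andP; split.
  apply: ge_ereal_sup => _ [phi tphi <-].
  have mfd : measurable_fun [set: ct] (EFin \o (fun x : ct => f x * div2 phi x)).
    exact: ((measurable_EFinP _ _).2
      (measurable_funM mf (measurable_fun_ct (measurable_div2 tphi)))).
  by rewrite (null _ mfd)// => x /f0 fx; rewrite /= fx mul0r.
(* The supremum is over a nonempty family: the zero field contributes the value 0. *)
apply: ereal_sup_ubound; exists (fun=> (0, 0)); first exact: test_field0.
by rewrite integral0_eq// => x _; rewrite div20 mulr0.
Qed.

(** Components lie in the complement of [S] only up to null sets, so two null parts are needed: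
    inside [S] by the definition of components, and outside [S] by saturation if the component were
    a hole. A component has positive measure. *)
Lemma component_infinite (S : set (R * R)) (C : set (set (R * R))) (A : set (R * R)) :
  indecomposable_components (~` S) C ->
  L2 (S `+` (S `|` \bigcup_(H in holes C) H)) = 0%E -> C A -> L2 A = +oo%E.
Proof.
move=> [_ [comp diff _ _]] hol CA; apply/eqP; apply: contraT => Aoo.
have [_ Apos] := comp A CA.
have AS : L2 (A `&` S) = 0%E.
  apply: lebesgue2_null_sub diff => x [Ax Sx]; rewrite setY_def; right.
  by split; [exists A|move=> /(_ Sx)].
have AnS : L2 (A `\` S) = 0%E.
  apply: lebesgue2_null_sub hol => x [Ax nSx]; rewrite setY_def; right.
  split => //; right; exists A => //; split => //.
  by rewrite ltey.
have := lebesgue2_nullU AS AnS; rewrite setUIDK => A0.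
by rewrite A0 ltxx in Apos.
Qed.

(** Restricting to rational boxes makes the union countable, so that the excess over [S] stays
    null. *)
Definition essential_interior (S : set (R * R)) : set (R * R) :=
  \bigcup_(q in [set q : (rat * rat) * (rat * rat) |
     L2 (box (ratr q.1.1) (ratr q.1.2) (ratr q.2.1) (ratr q.2.2) `\` S) = 0%E])
     box (ratr q.1.1) (ratr q.1.2) (ratr q.2.1) (ratr q.2.2).

Lemma open_box (a b c d : R) : open (box a b c d).
Proof.
rewrite openE => -[x y] [/= xab ycd]; exists (`]a, b[%classic, `]c, d[%classic) => //=.
by split; apply: open_nbhs_nbhs; split => //; exact: interval_open.
Qed.

Lemma open_essential_interior S : open (essential_interior S).
Proof. by apply: bigcup_open => q _; exact: open_box. Qed.

Lemma essential_interior_null S : L2 (essential_interior S `\` S) = 0%E.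
Proof.
rewrite setD_bigcupl; apply: lebesgue2_null_bigcup => [|q //]; exact: countableP.
Qed.

Lemma box_essential_interior S (a b c d : R) : L2 (box a b c d `\` S) = 0%E ->
  box a b c d `<=` essential_interior S.
Proof.
move=> n0 x; rewrite [in X in X -> _](open_rat_boxes (@open_box a b c d)) => -[q qS qx].
exists q => //; apply: lebesgue2_null_sub n0; exact: setSD.
Qed.

Lemma box_null (S S0 : set (R * R)) (C : set (set (R * R))) (a b c d : R) :
  lebesgue2_measurable S -> measurable S0 -> L2 (S `+` S0) = 0%E ->
  indecomposable_components (~` S) C -> (forall A, C A -> L2 A = +oo%E) ->
  a < b -> c < d -> thin_frame S0 a b c d -> L2 (box a b c d `\` S) = 0%E.
Proof.
move=> mS mS0 SS0 [[_ cC _] [comp diff _ _]] Coo ab cd thin.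
have mbox : lebesgue2_measurable (box a b c d).
  by apply: lebesgue2_measurable_borel; exact: measurableX.
have boxoo : (L2 (box a b c d) < +oo)%E by rewrite lebesgue2_box ?ltry// ltW.
have AS A : C A -> L2 (A `&` S) = 0%E.
  move=> CA; apply: lebesgue2_null_sub diff => x [Ax Sx]; rewrite setY_def; right.
  by split; [exists A|move=> /(_ Sx)].
have Abox A : C A -> L2 (A `&` box a b c d) = 0%E.
  move=> CA; have [[[mA Aoo] indec] _] := comp A CA.
  have mAb : lebesgue2_measurable (A `&` box a b c d).
    by apply: caratheodory_measurable_setI.
  have mAnb : lebesgue2_measurable (A `\` box a b c d).
    by apply: caratheodory_measurable_setD.
  have cut : perimeter A = (perimeter (A `&` box a b c d) + perimeter (A `\` box a b c d))%E.
    apply: perimeter_cut => // e e0; have [r [re abr cdr hr]] := thin e e0.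
    exists r; split => //; apply: le_trans hr.
    (* In the frame, [A] is contained in the complement of [S0] up to null sets: [A] meets [S] in a
       null set, and [S] differs from [S0] by another. *)
    apply: (@le_trans _ _ (L2 ((~` S0 `&` frame a b c d r) `|` ((A `&` S) `|` (S `+` S0))))).
      apply: le_lebesgue2 => x [Ax Fx]; have [S0x|nS0x] := pselect (S0 x); last by left.
      right; have [Sx|nSx] := pselect (S x); first by left.
      by right; rewrite setY_def; right.
    apply: le_trans (lebesgue2U _ _) _.
    by rewrite (lebesgue2_nullU (AS A CA) SS0) adde0.
  have dis : (A `&` box a b c d) `&` (A `\` box a b c d) = set0.
    by rewrite setDE setIACA setICr setI0.
  have [h|An] := indec _ _ mAb mAnb (esym (setUIDK _ _)) dis cut; first exact: h.
  have : (L2 A <= L2 (A `&` box a b c d) + L2 (A `\` box a b c d))%E.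
    by rewrite -{1}(setUIDK A (box a b c d)); exact: lebesgue2U.
  rewrite An adde0 (Coo A CA) leye_eq => /eqP h.
  have : (L2 (A `&` box a b c d) < +oo)%E.
    by apply: le_lt_trans boxoo; apply: le_lebesgue2; exact: subIsetr.
  by rewrite h.
(* The components are countably many and cover the complement of [S] up to a null set, so the null
   traces on the box add up to a null set. *)
apply: (@lebesgue2_null_sub _ _ ((\bigcup_(A in C) (A `&` box a b c d)) `|`
   (~` S `+` \bigcup_(A in C) A))).
  move=> x [bx nSx]; have [[A CA Ax]|nC] := pselect ((\bigcup_(A in C) A) x).
    by left; exists A.
  by right; rewrite setY_def; left.
by apply: lebesgue2_nullU => //; apply: lebesgue2_null_bigcup.
Qed.

End conclusion.

Theorem corollary5 (R : realType) (S : set (R * R)) :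
  indecomposable S -> saturated S ->
  exists2 U : set (R * R), open U & BVnorm (\1_S \- \1_U) = 0%E.
Proof.
move=> _ [[mS Soo] [C compC holC]].
(* The lines are studied on the Borel set [S0], whose fluxes agree with those of [S] and are thus
   bounded by its perimeter; the components still belong to the complement of [S]. *)
have [S0 mS0 SS0] := lebesgue2_borel_version mS.
have mS02 := lebesgue2_measurable_borel mS0.
have Coo A : C A -> lebesgue2 A = +oo%E by exact: component_infinite compC holC.
have Sfin : perimeter S \is a fin_num by rewrite ge0_fin_numE; [|exact: perimeter_ge0].
have S0M phi : test_field phi -> flux S0 phi <= fine (perimeter S).
  move=> tphi; rewrite -(flux_eq tphi mS mS02 SS0) -lee_fin (fineK Sfin).
  exact: perimeter_ge.
have oU := @open_essential_interior R S.
exists (essential_interior S) => //.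
have mU : lebesgue2_measurable (essential_interior S).
  by apply: lebesgue2_measurable_borel; exact: open_measurable_plane.
apply: BVnorm_null => //; rewrite setY_def; apply: lebesgue2_nullU; last first.
  exact: essential_interior_null.
have S0U : lebesgue2 (S0 `\` essential_interior S) = 0%E.
  apply: (open_hull_null mS0 S0M) => a b c d ab cd thin.
  by apply: box_essential_interior; exact: (box_null mS mS0 SS0 compC Coo).
apply: (@lebesgue2_null_sub _ _ ((S `+` S0) `|` (S0 `\` essential_interior S))).
  move=> x [Sx nUx]; have [S0x|nS0x] := pselect (S0 x); first by right.
  by left; rewrite setY_def; left.
exact: lebesgue2_nullU.
Qed.
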